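(* Let $X$ be a finite model of the real projective plane. Then $\# X\geq 13$.
   Context: A finite model of a topological space $Z$ is a finite topological space which is weak homotopy equivalent to $Z$, i.e. connected to $Z$ by a zigzag of weak homotopy equivalences. $\#X$ denotes the number of points of $X$. *)

(* Defs.v *)
From Stdlib Require Import Relation_Operators.
From mathcomp Require Import all_boot all_order all_algebra.
From mathcomp Require Import generic_quotient finmap.
From mathcomp Require Import all_classical all_reals all_analysis.
From mathcomp Require Import lra.

Set Implicit Arguments.
Unset Strict Implicit.
Unset Printing Implicit Defensive.

Import Order.TTheory GRing.Theory Num.Theory.
Import numFieldNormedType.Exports.

Local Open Scope classical_set_scope.
Local Open Scope ring_scope.
Local Open Scope quotient_scope.

Lemma within_continuous_comp (T U V : topologicalType) (A : set T) (B : set U)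
    (f : T -> U) (g : U -> V) :
  continuous f -> (forall t, A t -> B (f t)) ->
  {within B, continuous g} -> {within A, continuous (g \o f)}.
Proof.
move=> cf AB; rewrite !subspace_continuousP => cg t At W nW.
have fW : nbhs t [set u | B (f u) -> W (g (f u))].
  exact: cf t _ (cg _ (AB _ At) W nW).
suff : nbhs t [set u | A u -> W (g (f u))] by [].
by apply: filterS fW => u /= gu /AB.
Qed.

Section homotopy_relation.
Context {R : realType} {T X : topologicalType}.

Definition is_homotopy_rel (B : set T) (f g : T -> X) (H : R * T -> X) :=
  [/\ {within `[0, 1] `*` [set: T], continuous H},
      forall t, H (0, t) = f t,
      forall t, H (1, t) = g t &
      forall (s : R) t, 0 <= s <= 1 -> B t -> H (s, t) = f t].

Definition homotopic_rel (B : set T) (f g : T -> X) :=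
  exists H, is_homotopy_rel B f g H.

Let cylinder (a b : R) : set (R * T) := `[a, b] `*` [set: T].

Let closed_cylinder a b : closed (cylinder a b).
Proof.
rewrite (_ : cylinder a b = fst @^-1` `[a, b]).
  by apply: preimage_closed; [move=> ? _; exact: cvg_fst | exact: itv_closed].
by rewrite eqEsubset; split=> [p []|p ?].
Qed.

Let reparam (c d : R) (p : R * T) : R * T := (c * p.1 + d, p.2).

Let reparam_continuous c d : continuous (reparam c d).
Proof.
move=> p; have c1 : (c * q.1 + d) @[q --> p] --> c * p.1 + d.
  apply: cvgD; last exact: cvg_cst.
  by apply: cvgMl_tmp; case: p => ? ?; exact: cvg_fst.
have c2 : q.2 @[q --> p] --> p.2 by case: p {c1} => ? ?; exact: cvg_snd.
exact: (cvg_pair c1 c2).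
Qed.

Let within_reparam (H : R * T -> X) a b c d :
  (forall s, a <= s <= b -> 0 <= c * s + d <= 1) ->
  {within cylinder 0 1, continuous H} ->
  {within cylinder a b, continuous (H \o reparam c d)}.
Proof.
move=> cd; apply: within_continuous_comp; first exact: reparam_continuous.
by move=> p [/= pab _]; split=> //=; move: pab; rewrite !in_itv /= => /cd.
Qed.

Lemma homotopic_rel_refl B (f : T -> X) : continuous f -> homotopic_rel B f f.
Proof.
move=> cf; exists (f \o snd); split=> //.
by apply: continuous_subspaceT => p; apply: continuous_comp;
  [exact: cvg_snd | exact: cf].
Qed.

Lemma homotopic_rel_sym B (f g : T -> X) :
  homotopic_rel B f g -> homotopic_rel B g f.
Proof.
case=> H [cH H0 H1 HB]; exists (H \o reparam (-1) 1); split=> /=.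
- by apply: within_reparam => // s; lra.
- by move=> t; rewrite /reparam /= mulr0 add0r H1.
- by move=> t; rewrite /reparam /= mulr1 addNr H0.
move=> s t s01 Bt; rewrite /reparam /= HB //; last by lra.
by rewrite -H1 HB // ler01 lexx.
Qed.

Lemma homotopic_rel_trans B (f g h : T -> X) :
  homotopic_rel B f g -> homotopic_rel B g h -> homotopic_rel B f h.
Proof.
move=> [H [cH H0 H1 HB]] [K [cK K0 K1 KB]].
pose L (p : R * T) :=
  if p.1 <= 2^-1 then H (reparam 2 0 p) else K (reparam 2 (-1) p).
have HK t : H (1, t) = K (0, t) by rewrite H1 K0.
exists L; split.
- have -> : `[0, 1] `*` [set: T] = cylinder 0 2^-1 `|` cylinder 2^-1 1.
    rewrite eqEsubset; split=> [[s t] [/= s01 _] | [s t] [] [/= s01 _]].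
    + have [s2|s2] := leP s 2^-1; [left|right]; split=> //=;
        by move: s01; rewrite /= !in_itv /=; lra.
    + by split=> //=; move: s01; rewrite /= !in_itv /=; lra.
    + by split=> //=; move: s01; rewrite /= !in_itv /=; lra.
  apply: withinU_continuous; [exact: closed_cylinder..| |].
  + apply: (@subspace_eq_continuous _ _ _ (H \o reparam 2 0)).
      move=> [s t] /set_mem [/= s2 _]; rewrite /from_subspace /L /= ifT //.
      by move: s2; rewrite in_itv /=; lra.
    by apply: within_reparam => // s; lra.
  + apply: (@subspace_eq_continuous _ _ _ (K \o reparam 2 (-1))).
      move=> [s t] /set_mem [/= s2 _]; rewrite /from_subspace /L /=.
      case: ifP => // s2'.
      have -> : s = 2^-1 by move: s2 s2'; rewrite in_itv /=; lra.
      by rewrite /reparam /= mulfV ?addr0 ?subrr ?HK // pnatr_eq0.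
    by apply: within_reparam => // s; lra.
- move=> t; rewrite /L /= ifT ?invr_ge0 //.
  by rewrite /reparam /= mulr0 addr0 H0.
- move=> t; rewrite /L /= ifF; last by apply/negbTE; rewrite -ltNge; lra.
  by rewrite /reparam /= -K1; congr (K (_, _)); lra.
move=> s t s01 Bt; have fg : f t = g t by rewrite -H1 HB // ler01 lexx.
rewrite /L /=; case: ifPn => s2; first by rewrite HB //=; lra.
by move: s2; rewrite -ltNge => s2; rewrite KB //=; lra.
Qed.

End homotopy_relation.

Section postcomposition.
Context {R : realType} {T X Y : topologicalType}.

Lemma homotopic_rel_comp (phi : X -> Y) (B : set T) (f g : T -> X) :
  continuous phi -> @homotopic_rel R T X B f g ->
  @homotopic_rel R T Y B (phi \o f) (phi \o g).
Proof.
move=> cphi [H [cH H0 H1 HB]]; exists (phi \o H); split=> /=.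
- by move=> p W /cphi nW; exact: (cH p _ nW).
- by move=> t; rewrite H0.
- by move=> t; rewrite H1.
- by move=> s t s01 Bt; rewrite HB.
Qed.

End postcomposition.

Section path_components.
Context (R : realType) (X : topologicalType).

Definition path_related : rel X := fun x y =>
  `[< exists g : R -> X,
        [/\ {within `[0, 1], continuous g}, g 0 = x & g 1 = y] >].

Lemma path_relatedP x y : reflect
  (@homotopic_rel R R X set0 (cst x) (cst y)) (path_related x y).
Proof.
rewrite /path_related.
apply: (iffP (asboolP _)) => [[g [cg g0 g1]]|[H [cH H0 H1 _]]].
  exists (g \o fst); split=> //.
  by apply: within_continuous_comp cg; [move=> ?; exact: cvg_fst | move=> ? []].
exists (fun s => H (s, 0)); split=> //.
apply: within_continuous_comp cH => // s.
exact: (cvg_pair (@cvg_id _ (nbhs s)) (@cvg_cst _ 0 _ (nbhs s) _)).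
Qed.

Lemma path_related_refl : reflexive path_related.
Proof.
by move=> x; apply/path_relatedP/homotopic_rel_refl => ?; exact: cvg_cst.
Qed.

Lemma path_related_sym : symmetric path_related.
Proof.
by move=> x y; apply/path_relatedP/path_relatedP; exact: homotopic_rel_sym.
Qed.

Lemma path_related_trans : transitive path_related.
Proof.
move=> y x z /path_relatedP xy /path_relatedP yz; apply/path_relatedP.
exact: homotopic_rel_trans xy yz.
Qed.

Canonical path_related_equiv := EquivRel path_related
  path_related_refl path_related_sym path_related_trans.

Definition pi0 := {eq_quot path_related_equiv}.

End path_components.

Section pi0_map.
Context (R : realType) {X Y : topologicalType} (phi : continuousType X Y).

Definition pi0_map (c : pi0 R X) : pi0 R Y := \pi_(pi0 R Y) (phi (repr c)).

Lemma pi0_mapE x : pi0_map (\pi_(pi0 R X) x) = \pi_(pi0 R Y) (phi x).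
Proof.
apply/eqmodP/path_relatedP.
have /eqmodP/path_relatedP : repr (\pi_(pi0 R X) x) = x %[mod pi0 R X].
  by rewrite reprK.
exact/homotopic_rel_comp/cts_fun.
Qed.

End pi0_map.

Section homotopy_groups.
Context (R : realType).

Definition cube n : set 'rV[R]_n := [set t | forall i, 0 <= t 0 i <= 1].
Arguments cube : clear implicits.

Definition cube_boundary n : set (cube n) :=
  [set t | exists i, (val t : 'rV[R]_n) 0 i = 0 \/ (val t : 'rV[R]_n) 0 i = 1].
Arguments cube_boundary : clear implicits.

(* Maps of pairs (I^n, boundary of I^n) -> (X, x). *)
Definition loop n (X : topologicalType) (x : X) :=
  {g : continuousType (cube n) X | `[< forall t, cube_boundary n t -> g t = x >]}.

Section quotient.
Context (n : nat) (X : topologicalType) (x : X).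

Definition loop_homotopic : rel (loop n x) := fun g h =>
  `[< @homotopic_rel R (cube n) X (cube_boundary n) (val g) (val h) >].

Lemma loop_homotopic_refl : reflexive loop_homotopic.
Proof. by move=> g; apply/asboolP/homotopic_rel_refl/cts_fun. Qed.

Lemma loop_homotopic_sym : symmetric loop_homotopic.
Proof. by move=> g h; apply/asboolP/asboolP; exact: homotopic_rel_sym. Qed.

Lemma loop_homotopic_trans : transitive loop_homotopic.
Proof.
move=> h g k /asboolP gh /asboolP hk; apply/asboolP.
exact: homotopic_rel_trans gh hk.
Qed.

Canonical loop_homotopic_equiv := EquivRel loop_homotopic
  loop_homotopic_refl loop_homotopic_sym loop_homotopic_trans.

Definition homotopy_group := {eq_quot loop_homotopic_equiv}.

End quotient.

Section induced_map.
Context (n : nat) {X Y : topologicalType} (phi : continuousType X Y) (x : X).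

Lemma loop_map_subproof (g : loop n x) :
  `[< forall t, cube_boundary n t -> (phi \o val g) t = phi x >].
Proof. by apply/asboolP => t bt /=; rewrite (asboolP _ (valP g)). Qed.

Definition loop_map (g : loop n x) : loop n (phi x) :=
  exist _ (phi \o val g : continuousType _ _) (loop_map_subproof g).

Definition homotopy_group_map (c : homotopy_group n x) :
    homotopy_group n (phi x) :=
  \pi_(homotopy_group n (phi x)) (loop_map (repr c)).

Lemma homotopy_group_mapE (g : loop n x) :
  homotopy_group_map (\pi_(homotopy_group n x) g) =
  \pi_(homotopy_group n (phi x)) (loop_map g).
Proof.
apply/eqmodP/asboolP.
have /eqmodP/asboolP : repr (\pi_(homotopy_group n x) g) = g
  %[mod homotopy_group n x] by rewrite reprK.
exact/homotopic_rel_comp/cts_fun.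
Qed.

End induced_map.
End homotopy_groups.

Section weak_homotopy_equivalence.
Context (R : realType).

(* pi0 is treated apart, as a map of unpointed sets, so that the empty space is
   only equivalent to itself. The maps induced on homotopy groups are group
   morphisms by construction (composition with phi commutes with concatenation
   of loops), so they are isomorphisms exactly when they are bijective. *)
Definition weak_homotopy_equivalence (X Y : topologicalType)
    (phi : continuousType X Y) :=
  bijective (@pi0_map R X Y phi) /\
  forall (n : nat) (x : X), (0 < n)%N ->
    bijective (@homotopy_group_map R n X Y phi x).

(* Zigzags of weak homotopy equivalences. *)
Definition weak_homotopy_equivalent :
    topologicalType -> topologicalType -> Prop :=
  clos_refl_sym_trans topologicalType
    (fun X Y => exists phi : continuousType X Y, weak_homotopy_equivalence phi).

Definition finite_model (Z X : topologicalType) :=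
  finite_set [set: X] /\ weak_homotopy_equivalent X Z.

End weak_homotopy_equivalence.

Section projective_space.
Context (R : realType) (n : nat).

Definition sphere : set 'rV[R]_n.+1 := [set v | \sum_i v 0 i ^+ 2 = 1].

Definition antipodal : rel sphere :=
  fun u v => (val u == val v) || (val u == - val v).

Lemma antipodal_refl : reflexive antipodal.
Proof. by move=> u; rewrite /antipodal eqxx. Qed.

Lemma antipodal_sym : symmetric antipodal.
Proof.
move=> u v; rewrite /antipodal eq_sym; congr orb.
by apply/eqP/eqP => ->; rewrite opprK.
Qed.

Lemma antipodal_trans : transitive antipodal.
Proof.
move=> v u w /orP[] /eqP uv /orP[] /eqP vw;
  by rewrite /antipodal uv vw ?opprK eqxx ?orbT.
Qed.

Canonical antipodal_equiv := EquivRel antipodal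
  antipodal_refl antipodal_sym antipodal_trans.

Definition projective_space : topologicalType :=
  quotient_topology {eq_quot antipodal_equiv}.

End projective_space.
Arguments sphere : clear implicits.

(* Main.v *)
Require Import Defs.
From HB Require Import structures.
From mathcomp Require Import all_boot all_order all_algebra.
From mathcomp Require Import generic_quotient finmap boolp.
From mathcomp Require Import zify lra ring.

(** Two facts about the projective plane are used: it is path connected, and
    its fundamental group has two elements. Both pass to every space [X] that is
    weakly equivalent to it ([projective_like_equiv]), and they hold by covering
    space theory, the sphere being simply connected
    ([sphere_simply_connected], [projective_plane_like]).

    Let [X] be finite, with its specialization preorder: [x <= y] when [x] lies
    in every open set around [y]. Two paths with the same ends inside the
    smallest open set of a point are homotopic, so a comparability [x <= y] has
    a class in the fundamental groupoid. Closing it up with fixed paths from a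
    base point gives an element of the fundamental group, hence a cocycle on the
    preorder with values in Z/2 ([edge_twist]). If it were the reduction modulo
    2 of an integral cocycle [c], then the winding number with respect to [c]
    would be additive and homotopy invariant on paths, and odd on the nontrivial
    loop [a]; but [a] followed by [a] is null-homotopic, so twice an odd number
    would be zero ([no_integral_cocycle]). In other words, the class of the
    double cover of [X] has a nonzero Bockstein.

    It remains to lift every mod 2 cocycle on a preorder with at most twelve
    points to the integers ([integral_cocycle]). Such a cocycle is determined by
    its values between minimal points (rows) and maximal points (columns), up to
    equivalence of points in the preorder. Every remaining point contributes
    one condition: the lift has to be balanced on the rectangle formed by the
    rows below it and the columns above it. The count is then about [p] rows,
    [q] columns and [r] rectangles ([liftable_twelve]).
    - With at most three rows, a lift can fail only if each of the three pairs
      of rows and each of the two signs has its own rectangle, and then there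
      are at least six rectangles and four columns, hence thirteen points
      ([liftable_few_rows]). This is the face poset of the hemicube. By symmetry
      the same holds with at most three columns.
    - Four rectangles never obstruct a lift ([liftable_four]).
    - Otherwise [p] and [q] are at least 4 and [r] is at least 5. *)

Set Implicit Arguments.
Unset Strict Implicit.
Unset Printing Implicit Defensive.

Import Order.TTheory GRing.Theory Num.Theory.

Local Open Scope ring_scope.

(** * Lifting a sign matrix over balanced rectangles *)

Definition oddz (a : int) : bool := odd `|a|%N.

Lemma oddzD a b : oddz (a + b) = oddz a (+) oddz b.
Proof. rewrite /oddz; lia. Qed.

Lemma oddzN a : oddz (- a) = oddz a.
Proof. rewrite /oddz; lia. Qed.

Lemma oddzB a b : oddz (a - b) = oddz a (+) oddz b.
Proof. by rewrite oddzD oddzN. Qed.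

Lemma oddzb (b : bool) : oddz (nat_of_bool b)%:Z = b.
Proof. by case: b. Qed.

Section rectangles.
Variables P Q I : finType.
Implicit Types (M : P -> Q -> bool) (RP : I -> {set P}) (RQ : I -> {set Q}).

(** Equivalently, on each rectangle [M m n] is the sum of a function of the row
    [m] and a function of the column [n]. *)
Definition balanced M RP RQ := forall i m m' n n',
  m \in RP i -> m' \in RP i -> n \in RQ i -> n' \in RQ i ->
  M m n (+) M m' n = M m n' (+) M m' n'.

(** The lift is integral because the topological argument needs a target without
    2-torsion. *)
Definition liftable M RP RQ := exists c : P -> Q -> int,
  (forall m n, oddz (c m n) = M m n) /\
  forall i m m' n n',
    m \in RP i -> m' \in RP i -> n \in RQ i -> n' \in RQ i ->
    c m n - c m' n = c m n' - c m' n'.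

(** Once one column potential [g] serves all rectangles, [M m n] differs from
    [g n] by a constant along the part of a row that lies in a rectangle, and
    constants can be lifted arbitrarily. *)
Lemma liftable_potential M RP RQ (g : Q -> bool) :
    (forall i m n n', m \in RP i -> n \in RQ i -> n' \in RQ i ->
       M m n (+) M m n' = g n (+) g n') ->
  liftable M RP RQ.
Proof.
move=> Mg; exists (fun m n => (g n : nat)%:Z + (M m n (+) g n : nat)%:Z).
split=> [m n|i m m' n n' mi m'i ni n'i].
  by rewrite oddzD !oddzb addbC -addbA addbb addbF.
have e1 := Mg i m n n' mi ni n'i; have e2 := Mg i m' n n' m'i ni n'i.
by move: e1 e2; case: (M m n) (M m n') (M m' n) (M m' n') (g n) (g n')
  => [] [] [] [] [] [].
Qed.

(** Row [m] can copy the lift of row [m']: on each rectangle through [m] the two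
    rows of [M] differ by a constant, so adding the lift of that difference
    keeps the rectangle balanced. *)
Lemma liftable_dominated M RP RQ m m' : balanced M RP RQ ->
    m' != m -> (forall i, m \in RP i -> m' \in RP i) ->
  liftable M (fun i => RP i :\ m) RQ -> liftable M RP RQ.
Proof.
move=> bM m'm dom [c [cM cR]].
pose d n := c m' n + (M m n (+) M m' n : nat)%:Z.
exists (fun k n => if k == m then d n else c k n); split=> [k n|i].
  case: eqP => [->|_//]; rewrite /d oddzD cM oddzb.
  by rewrite addbC -addbA addbb addbF.
have key k n n' : k != m -> m \in RP i -> k \in RP i ->
    n \in RQ i -> n' \in RQ i -> d n - c k n = d n' - c k n'.
  move=> km mi ki ni n'i; rewrite /d.
  have m'i := dom _ mi.
  rewrite (bM i m m' n n') //.
  have := cR i m' k n n'; rewrite !inE m'm km ki m'i ni n'i.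
  by move=> /(_ isT isT isT isT); lia.
move=> k k' n n' ki k'i ni n'i.
case: (eqVneq k m) => [e|km]; case: (eqVneq k' m) => [e'|k'm].
- by rewrite !subrr.
- by apply: key => //; rewrite -e.
- by have := key k n n' km; rewrite -e' k'i ki => /(_ isT isT ni n'i); lia.
by apply: (cR i); rewrite // !inE ?km ?k'm.
Qed.

(** The columns of the rectangles in [l] form a union in which, starting from the
    end of [l], each new rectangle touches the previous ones in at most one
    column. Such a union has no cycles, so nothing obstructs gluing along it. *)
Fixpoint forest RQ (l : seq I) : bool :=
  if l is i :: l' then
    forest RQ l' && (#|RQ i :&: \bigcup_(j <- l') RQ j| <= 1)%N
  else true.

(** The single column that a new rectangle shares with the previous ones fixes
    the constant by which its profile has to be shifted. This constant is even,
    because all profiles have the parity [x0]. *)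
Lemma glue_forest RQ (x0 : Q -> bool) (phi : I -> Q -> int) l :
    forest RQ l -> (forall i n, oddz (phi i n) = x0 n) ->
  exists x : Q -> int, (forall n, oddz (x n) = x0 n) /\
    forall i n n', i \in l -> n \in RQ i -> n' \in RQ i ->
      x n - phi i n = x n' - phi i n'.
Proof.
move=> + phiP; elim: l => [_|i l IH /= /andP[/IH[x [xP xR]]]].
  by exists (fun n => (x0 n : nat)%:Z); split=> // n; rewrite oddzb.
move=> cI; pose U := \bigcup_(j <- l) RQ j.
(* The shift that makes [phi i] agree with [x] on the common column. *)
pose delta := if [pick n in RQ i :&: U] is Some n0 then x n0 - phi i n0 else 0.
have odelta : oddz delta = false.
  by rewrite /delta; case: pickP => // n0 _; rewrite oddzB xP phiP addbb.
exists (fun n => if n \in U then x n else phi i n + delta); split=> [n|].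
  by case: ifP => // _; rewrite oddzD odelta addbF.
have xi n : n \in RQ i -> (if n \in U then x n else phi i n + delta) =
    phi i n + delta.
  case: ifP => // nU ni; rewrite /delta; case: pickP => [n0 n0P|/(_ n)].
    have -> : n0 = n.
      apply: (card_le1_eqP cI) => //.
      by rewrite inE ni.
    lia.
  by rewrite inE ni nU.
move=> j n n'; rewrite in_cons => /predU1P[->|jl] nj n'j.
  by rewrite !xi //; lia.
have inU k : k \in RQ j -> k \in U
  by move=> kj; rewrite /U bigcup_seq; apply/bigcupP; exists j.
by rewrite !inU //; apply: xR.
Qed.

(** The rectangles through row [m] prescribe that row up to one constant for
    each of them; along a forest these prescriptions are compatible. *)
Lemma liftable_forest M RP RQ m l : balanced M RP RQ ->
    (forall i, m \in RP i -> i \in l) -> forest RQ l ->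
  liftable M (fun i => RP i :\ m) RQ -> liftable M RP RQ.
Proof.
move=> bM ml fl [c [cM cR]].
(* The profile that rectangle [i] prescribes for row [m], read off from any
   other row of the rectangle. *)
pose phi i n : int := if [pick k in RP i :\ m] is Some k
  then c k n + (M m n (+) M k n : nat)%:Z else (M m n : nat)%:Z.
have phiP i n : oddz (phi i n) = M m n.
  rewrite /phi; case: pickP => [k _|_]; last by rewrite oddzb.
  by rewrite oddzD oddzb cM addbC -addbA addbb addbF.
have [x [xP xR]] := glue_forest fl phiP.
exists (fun k n => if k == m then x n else c k n); split=> [k n|i].
  by case: eqP => [->|_].
have key k n n' : k != m -> m \in RP i -> k \in RP i ->
    n \in RQ i -> n' \in RQ i -> x n - c k n = x n' - c k n'.
  move=> km mi ki ni n'i.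
  have := xR i n n' (ml _ mi) ni n'i; rewrite /phi.
  case: pickP => [k0|/(_ k)]; last by rewrite !inE km ki.
  rewrite !inE => /andP[k0m k0i]; rewrite (bM i m k0 n n') //.
  have := cR i k0 k n n'; rewrite !inE k0m km k0i ki ni n'i.
  by move=> /(_ isT isT isT isT); lia.
move=> k k' n n' ki k'i ni n'i.
case: (eqVneq k m) => [e|km]; case: (eqVneq k' m) => [e'|k'm].
- by rewrite !subrr.
- by apply: key => //; rewrite -e.
- by have := key k n n' km; rewrite -e' k'i ki => /(_ isT isT ni n'i); lia.
by apply: (cR i); rewrite // !inE ?km ?k'm.
Qed.

(** On a rectangle that contains both rows their difference is constant modulo
    2, so its lift to 0 and 1 is constant too. *)
Lemma liftable_two_rows M RP RQ r s : balanced M RP RQ ->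
  (forall i, RP i \subset [set r; s]) -> liftable M RP RQ.
Proof.
move=> bM rs.
exists (fun m n => (M s n : nat)%:Z + (M m n (+) M s n : nat)%:Z); split=> [m n|].
  by rewrite oddzD !oddzb addbC -addbA addbb addbF.
move=> i m m' n n' mi m'i ni n'i.
have [mrs m'rs] := (subsetP (rs i) _ mi, subsetP (rs i) _ m'i).
move: mrs m'rs mi m'i; rewrite !inE => /orP[]/eqP-> /orP[]/eqP-> ri si;
  rewrite ?addbb; have /= := bM i r s n n'; rewrite ?ri ?si ni n'i; lia.
Qed.

(** These rectangles tie the rows [r] and [s] together on the columns where they
    differ by [t], but do not see row [u]. A rectangle with one column imposes
    nothing, hence the bound on the number of columns. *)
Definition separates M RP RQ (r s u : P) (t : bool) (i : I) : bool :=
  [&& r \in RP i, s \in RP i, u \notin RP i, (1 < #|RQ i|)%N &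
      [exists n in RQ i, M r n (+) M s n == t]].

(** Relative to row [u], lift row [r] downwards and row [s] upwards (after
    changing the sign of row [s] by [t]). Then any two of the rows have a
    constant integral difference where their difference modulo 2 is a given
    constant, with one exception: for [r] and [s] on the columns where they
    differ by [t]. Rectangles that contain all three rows are balanced because
    the two pairs involving [u] are. *)
Lemma liftable_three_rows M RP RQ r s u t : balanced M RP RQ ->
    r != s -> r != u -> s != u -> (forall i, RP i \subset [set r; s; u]) ->
    (forall i, ~~ separates M RP RQ r s u t i) -> liftable M RP RQ.
Proof.
move=> bM rs ru su rsu nsep.
pose c m n : int := if m == r then (M u n : nat)%:Z - (M r n (+) M u n : nat)%:Z
  else if m == s then
    (M u n : nat)%:Z + (M s n (+) M u n (+) t : nat)%:Z + (t : nat)%:Z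
  else (M m n : nat)%:Z.
have cr n : c r n = (M u n : nat)%:Z - (M r n (+) M u n : nat)%:Z.
  by rewrite /c eqxx.
have cs n : c s n =
    (M u n : nat)%:Z + (M s n (+) M u n (+) t : nat)%:Z + (t : nat)%:Z.
  by rewrite /c eq_sym (negbTE rs) eqxx.
have cu n : c u n = (M u n : nat)%:Z.
  by rewrite /c ![u == _]eq_sym (negbTE ru) (negbTE su).
exists c; split=> [m n|i m m' n n' mi m'i ni n'i].
  rewrite /c; case: eqP => [->|_]; last case: eqP => [->|_].
  - by case: (M r n) (M u n) => [] [].
  - by move: (M s n) (M u n) (t) => [] [] [].
  - by rewrite oddzb.
have hru : r \in RP i -> u \in RP i -> c r n - c u n = c r n' - c u n'.
  by move=> ri ui; rewrite !cr !cu (bM i r u n n') // addrAC subrr [RHS]addrAC subrr.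
have hsu : s \in RP i -> u \in RP i -> c s n - c u n = c s n' - c u n'.
  move=> si ui; rewrite !cs !cu (bM i s u n n') //.
  by rewrite -!addrA addrC -!addrA addNr [RHS]addrC -!addrA addNr.
have hrs : r \in RP i -> s \in RP i -> c r n - c s n = c r n' - c s n'.
  move=> ri si; case: (boolP (u \in RP i)) => ui.
    by have := hru ri ui; have := hsu si ui; lia.
  have [cq|cq] := leqP #|RQ i| 1; first by rewrite (card_le1_eqP cq n n').
  have h k : k \in RQ i -> M r k (+) M u k = ~~ (M s k (+) M u k (+) t).
    move=> ki; have := nsep i; rewrite /separates ri si ui cq /= => /existsPn/(_ k).
    by rewrite ki /=; move: (M r k) (M s k) (M u k) (t) => [] [] [] [].
  have Nb (b : bool) : (~~ b : nat)%:Z = 1 - (b : nat)%:Z by case: b.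
  rewrite !cr !cs !h // !Nb.
  move: (Posz (M u n)) (Posz (M u n')) (Posz (_ (+) _)) (Posz (_ (+) _)) (Posz t).
  by clear=> *; lia.
have := subsetP (rsu i) _ mi; have := subsetP (rsu i) _ m'i.
rewrite !inE => /orP[/orP[]|]/eqP e' /orP[/orP[]|]/eqP e; subst m m';
  rewrite ?subrr // ?hru ?hsu ?hrs //.
- by have := hrs m'i mi; lia.
- by have := hru m'i mi; lia.
by have := hsu m'i mi; lia.
Qed.

(** With three rows, [liftable_three_rows] applies to each of the three pairs of
    rows and each of the two signs. If it never succeeds, the six separating
    rectangles are distinct: such a rectangle determines the row that it omits,
    and the sign because it is balanced. The two rectangles that belong to one
    pair of rows have no column in common and at least two columns each. *)
Lemma liftable_few_rows M RP RQ (A : {set P}) (B : {set Q}) :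
    balanced M RP RQ -> (forall i, RP i \subset A) ->
    (forall i, RQ i \subset B) -> (#|A| <= 3)%N ->
  liftable M RP RQ \/ [/\ #|A| = 3, 4 <= #|B| & 6 <= #|I|]%N.
Proof.
move=> bM RPA RQB A3.
have [A0|A0] := eqVneq A set0.
  left; exists (fun m n => (M m n : nat)%:Z); split=> [m n|i m m' n n'].
    exact: oddzb.
  by move=> /(subsetP (RPA i)); rewrite A0 inE.
have [r rA] := set0Pn _ A0.
have cr : #|A :\ r| = #|A|.-1 by rewrite (cardsD1 r A) rA.
have [s_r|s_r] := eqVneq (A :\ r) set0.
  left; apply: (@liftable_two_rows _ _ _ r r) => // i.
  apply: subset_trans (RPA i) _; apply/subsetP => x xA; rewrite !inE orbb.
  by apply: contraT => xr; have := in_set0 x; rewrite -s_r !inE xr xA.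
have [s] := set0Pn _ s_r; rewrite !inE => /andP[sr sA].
have [u_s|u_s] := eqVneq ((A :\ r) :\ s) set0.
  left; apply: (@liftable_two_rows _ _ _ r s) => // i.
  apply: subset_trans (RPA i) _; apply/subsetP => x xA; rewrite !inE.
  apply: contraT; rewrite negb_or => /andP[xr xs].
  by have := in_set0 x; rewrite -u_s !inE xr xA xs.
have [u] := set0Pn _ u_s; rewrite !inE => /and3P[us ur uA].
have A_3 : #|A| = 3%N.
  apply/eqP; rewrite eqn_leq A3 (cardsD1 r) rA (cardsD1 s) !inE sr sA.
  by rewrite (cardsD1 u) !inE us ur uA.
have A_rsu : A = [set r; s; u].
  apply/esym/eqP; rewrite eqEcard A_3.
  rewrite (_ : #|_| = 3%N) ?leqnn ?andbT; last first.
    by rewrite setUC cardsU1 cards2 !inE negb_or us ur (eq_sym r) sr.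
  by apply/subsetP => x; rewrite !inE => /orP[/orP[]|]/eqP->.
(* Indexed modulo 3, so that [k + 1] and [k + 2] are the rows other than [k]. *)
pose row (k : 'I_3) := nth r [:: r; s; u] k.
have rowI : injective row.
  move=> i j /eqP; rewrite /row nth_uniq ?ltn_ord //=.
    by move=> /eqP; exact: val_inj.
  by rewrite !inE negb_or ![r == _]eq_sym sr ur eq_sym us.
have rowA : forall k1 k2 k3 : 'I_3, k1 != k2 -> k1 != k3 -> k2 != k3 ->
    A = [set row k1; row k2; row k3].
  move=> k1 k2 k3 k12 k13 k23; apply/esym/eqP; rewrite eqEcard A_3.
  apply/andP; split.
    apply/subsetP => x; rewrite !inE => /orP[/orP[]|]/eqP->;
    rewrite A_rsu !inE /row.
    - by case: k1 {k12 k13} => [[|[|[]]]] //= _; rewrite eqxx ?orbT.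
    - by case: k2 {k12 k23} => [[|[|[]]]] //= _; rewrite eqxx ?orbT.
    - by case: k3 {k13 k23} => [[|[|[]]]] //= _; rewrite eqxx ?orbT.
  rewrite setUC cardsU1 cards2 !inE !(inj_eq rowI) negb_or ![k3 == _]eq_sym.
  by rewrite k13 k23 k12.
pose sep (p : 'I_3 * bool) :=
  separates M RP RQ (row (p.1 + 1)) (row (p.1 + 2%:R)) (row p.1) p.2.
case: (boolP [forall p, [exists i, sep p i]]) => [/forallP sepP|]; last first.
  move=> /forallPn[[k t] /existsPn nsep]; left.
  have [k1 [k2 k12]] : [/\ k + 1 != k + 2%:R, k + 1 != k & k + 2%:R != k :> 'I_3].
    by split; case: k {nsep} => [[|[|[]]]].
  apply: (@liftable_three_rows _ _ _ (row (k + 1)) (row (k + 2%:R)) (row k) t) => //;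
    rewrite ?(inj_eq rowI) //.
  by move=> i; rewrite -(rowA (k + 1) (k + 2%:R) k).
right; split=> //.
  have /existsP[i /and5P[ri si _ ci /existsP[n /andP[ni /eqP tn]]]] := sepP (0, false).
  have /existsP[j /and5P[rj sj _ cj /existsP[n' /andP[n'j /eqP tn']]]] := sepP (0, true).
  have dis : RQ i :&: RQ j = set0.
    apply/eqP; rewrite -subset0; apply/subsetP => x; rewrite !inE => /andP[xi xj].
    have := bM i _ _ _ _ ri si ni xi; have := bM j _ _ _ _ rj sj n'j xj.
    by rewrite tn tn' /= => <-.
  rewrite (leq_trans (leq_add ci cj)) // -cardsUI dis cards0 addn0.
  by apply: subset_leq_card; rewrite subUset !RQB.
pose f p := xchoose (existsP (sepP p)).
have fP p : sep p (f p) := xchooseP (existsP (sepP p)).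
have <- : #|{: 'I_3 * bool}| = 6%N by rewrite card_prod card_ord card_bool.
apply: (leq_card f) => -[k t] [k' t'] e.
have := fP (k, t); have := fP (k', t'); rewrite -e; set i := f _.
move=> /and5P[/= r' s' u' _ /existsP[n' /andP[n'i /eqP tn']]].
move=> /and5P[/= r0 s0 u0 _ /existsP[n /andP[ni /eqP tn]]].
have kk' : k = k'.
  apply/eqP; apply: contraNT u' => kk'.
  have : (k' == k + 1) || (k' == k + 2%:R).
    by move: kk'; clear; case: k => [[|[|[|//]]] ?]; case: k' => [[|[|[|//]]] ?].
  by move=> /orP[]/eqP->.
by move: r' s' tn'; rewrite -kk' => r' s' tn'; rewrite -tn -tn' (bM i _ _ n n').
Qed.

End rectangles.

Section transpose.
Variables P Q I : finType.
Implicit Types (M : P -> Q -> bool) (RP : I -> {set P}) (RQ : I -> {set Q}).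

Lemma balanced_transpose M RP RQ :
  balanced M RP RQ -> balanced (fun n m => M m n) RQ RP.
Proof.
move=> bM i n n' m m' ni n'i mi m'i.
have := bM i m m' n n' mi m'i ni n'i.
by case: (M m n) (M m' n) (M m n') (M m' n') => [] [] [] [].
Qed.

Lemma liftable_transpose M RP RQ :
  liftable (fun n m => M m n) RQ RP -> liftable M RP RQ.
Proof.
move=> [c [cM cR]]; exists (fun m n => c n m); split=> [m n|]; first exact: cM.
move=> i m m' n n' mi m'i ni n'i.
by have := cR i n n' m m' ni n'i mi m'i; lia.
Qed.

End transpose.

(** * Four rectangles never obstruct a lift *)

Section subsets_of_four.
Implicit Types a b c d : seq bool.

(** Subsets of the set of four rectangles, as lists of four booleans so that the
    finite checks below can be computed. *)
Definition subsets4 : seq (seq bool) :=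
  iter 4 (fun s => [seq x :: l | x <- [:: true; false], l <- s]) [:: [::]].

Definition incl a b := all2 implb a b.

Definition incomparable a b := ~~ incl a b && ~~ incl b a.

Definition incomparable4 a b c d :=
  [&& incomparable a b, incomparable a c, incomparable a d,
      incomparable b c, incomparable b d & incomparable c d].

Definition pair4 a (ij : nat * nat) := nth false a ij.1 && nth false a ij.2.

Definition pairs4 := [:: (0, 1); (0, 2); (0, 3); (1, 2); (1, 3); (2, 3)]%N.

(** In an irreducible configuration each row, and each column, lies in two or in
    three of the four rectangles. *)
Definition medium4 := [seq a <- subsets4 | 1 < count_mem true a < 4]%N.

(** Two incomparable proper subsets that contain [i] and [j] are the triples
    [ijk] and [ijl]; a further set that is incomparable to both contains [k] and
    [l], so two of these can only be [ikl] and [jkl]. *)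
Lemma incomparable4_two_on_pair :
  all (fun ij => let on := [seq a <- medium4 | pair4 a ij] in
    all (fun a => all (fun b => if incl a b || incl b a then true else
      all (fun c => all (fun d => incomparable4 a b c d ==>
        all (fun x => count_mem true x == 3)%N [:: a; b; c; d])
      medium4) medium4) on) on) pairs4.
Proof. by vm_compute. Qed.

(** Among the subsets that do not contain both [i] and [j], a triple is
    incomparable to at most two others that are incomparable to each other. *)
Lemma incomparable4_none_on_pair :
  all (fun ij => let off := [seq a <- medium4 | ~~ pair4 a ij] in
    all (fun a => all (fun b => if incl a b || incl b a then true else
      all (fun c => all (fun d => incomparable4 a b c d ==>
        all (fun x => count_mem true x == 2)%N [:: a; b; c; d])
      off) off) off) off) pairs4.
Proof. by vm_compute. Qed.

End subsets_of_four.

Section four_rectangles.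
Variables P Q : finType.
Implicit Types (M : P -> Q -> bool) (RP : 'I_4 -> {set P}) (RQ : 'I_4 -> {set Q}).

Let i0 : 'I_4 := @Ordinal 4 0 isT.
Let i1 : 'I_4 := @Ordinal 4 1 isT.
Let i2 : 'I_4 := @Ordinal 4 2 isT.
Let i3 : 'I_4 := @Ordinal 4 3 isT.

Definition rects (T : finType) (RT : 'I_4 -> {set T}) (x : T) : seq bool :=
  [:: x \in RT i0; x \in RT i1; x \in RT i2; x \in RT i3].

Let I4P (K : 'I_4 -> Prop) : K i0 -> K i1 -> K i2 -> K i3 -> forall i, K i.
Proof.
move=> k0 k1 k2 k3 [[|[|[|[|//]]]] lt];
  by [rewrite (_ : Ordinal lt = i0) //; exact: val_inj
     |rewrite (_ : Ordinal lt = i1) //; exact: val_inj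
     |rewrite (_ : Ordinal lt = i2) //; exact: val_inj
     |rewrite (_ : Ordinal lt = i3) //; exact: val_inj].
Qed.

Section one_side.
Variables (T : finType) (RT : 'I_4 -> {set T}) (D : {set T}).
Hypothesis D4 : (4 <= #|D|)%N.
Hypothesis antichain : forall x y, x \in D -> y \in D -> x != y ->
  exists i, x \in RT i /\ y \notin RT i.
Hypothesis medium : forall x, x \in D -> rects RT x \in medium4.

Lemma rects_nth x (i : 'I_4) : nth false (rects RT x) i = (x \in RT i).
Proof. by move: i; apply: I4P. Qed.

Lemma rects_incl x y : x \in D -> y \in D ->
  incl (rects RT x) (rects RT y) = (x == y).
Proof.
move=> xD yD; have [->|xy] := eqVneq x y.
  by rewrite /incl /= !implybb.
have [i [xi yi]] := antichain xD yD xy; apply/negbTE.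
apply: contra yi; rewrite /incl /= => /and5P[h0 h1 h2 h3 _].
by move: i xi; apply: I4P; apply/implyP.
Qed.

Lemma rects_incomparable4 x y z w : x \in D -> y \in D -> z \in D -> w \in D ->
  uniq [:: x; y; z; w] ->
  incomparable4 (rects RT x) (rects RT y) (rects RT z) (rects RT w).
Proof.
move=> xD yD zD wD /=; rewrite !inE !negb_or andbT.
move=> /and3P[/and3P[xy xz xw] /andP[yz yw] zw].
rewrite /incomparable4 /incomparable !rects_incl //.
rewrite (eq_sym y x) (eq_sym z x) (eq_sym w x) (eq_sym z y) (eq_sym w y).
by rewrite (eq_sym w z) xy xz xw yz yw zw.
Qed.

Lemma fourth (s : seq T) : uniq s -> (size s <= 3)%N -> {subset s <= D} ->
  exists y, [/\ y \in D & y \notin s].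
Proof.
move=> us s3 sD; have : ~~ (D \subset s).
  apply: contraTN (leq_trans (s3 : size s < 4)%N D4) => Ds; rewrite -leqNgt.
  by apply: leq_trans (subset_leq_card Ds) (card_size s).
by move=> /subsetPn[y yD ys]; exists y.
Qed.

Lemma all_triples ij x y : ij \in pairs4 -> x \in D -> y \in D -> x != y ->
  pair4 (rects RT x) ij -> pair4 (rects RT y) ij ->
  forall z, z \in D -> count_mem true (rects RT z) = 3%N.
Proof.
move=> ijp xD yD xy xij yij z zD.
have xy_sub : {subset [:: x; y] <= D} by move=> t; rewrite !inE => /orP[]/eqP->.
have [u [uD uxy uz]] : exists u, [/\ u \in D, u \notin [:: x; y] & z \in [:: x; y; u]].
  case: (boolP (z \in [:: x; y])) => zxy.
    have [|//|//|u [uD uxy]] := @fourth [:: x; y]; first by rewrite /= inE xy.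
    by exists u; split=> //; move: zxy; rewrite !inE => /orP[]->; rewrite ?orbT.
  by exists z; split=> //; rewrite !inE eqxx !orbT.
have us : uniq [:: x; y; u].
  by move: uxy; rewrite /= !inE !negb_or xy ![u == _]eq_sym => /andP[-> ->].
have [//|//||w [wD wxyu]] := @fourth [:: x; y; u].
  by move=> t; rewrite !inE => /or3P[]/eqP->.
have inc : incomparable4 (rects RT x) (rects RT y) (rects RT u) (rects RT w).
  apply: rects_incomparable4 => //.
  by rewrite -[[:: x; y; u; w]]/(rcons [:: x; y; u] w) rcons_uniq wxyu us.
have /allP/(_ _ ijp)/allP/(_ (rects RT x)) := incomparable4_two_on_pair.
rewrite mem_filter xij medium // => /(_ isT)/allP/(_ (rects RT y)).
rewrite mem_filter yij medium // => /(_ isT).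
rewrite !rects_incl // (eq_sym y) (negbTE xy).
move=> /allP/(_ _ (medium uD))/allP/(_ _ (medium wD)); rewrite inc => /allP h.
move: uz; rewrite !inE => /or3P[]/eqP->; apply/eqP/h;
  by rewrite !inE eqxx ?orbT.
Qed.

Lemma all_pairs ij : ij \in pairs4 ->
  (forall x, x \in D -> ~~ pair4 (rects RT x) ij) ->
  forall x, x \in D -> count_mem true (rects RT x) = 2%N.
Proof.
move=> ijp noij x xD.
have [//|//||y [yD yx]] := @fourth [:: x]; first by move=> t; rewrite inE => /eqP->.
have xy : uniq [:: x; y] by rewrite /= inE andbT; move: yx; rewrite inE eq_sym.
have [//|//||z [zD zxy]] := @fourth [:: x; y].
  by move=> t; rewrite !inE => /orP[]/eqP->.
have us : uniq [:: x; y; z].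
  by rewrite -[[:: x; y; z]]/(rcons [:: x; y] z) rcons_uniq zxy xy.
have [//|//||w [wD wxyz]] := @fourth [:: x; y; z].
  by move=> t; rewrite !inE => /or3P[]/eqP->.
have inc : incomparable4 (rects RT x) (rects RT y) (rects RT z) (rects RT w).
  apply: rects_incomparable4 => //.
  by rewrite -[[:: x; y; z; w]]/(rcons [:: x; y; z] w) rcons_uniq wxyz us.
have off t : t \in D -> rects RT t \in [seq a <- medium4 | ~~ pair4 a ij].
  by move=> tD; rewrite mem_filter noij ?medium.
have /allP/(_ _ ijp)/allP/(_ (rects RT x) (off _ xD)) := incomparable4_none_on_pair.
move=> /allP/(_ (rects RT y) (off _ yD)).
have nxy : x == y = false by move: yx; rewrite inE eq_sym => /negbTE.
rewrite !rects_incl // (eq_sym y) nxy.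
move=> /allP/(_ _ (off _ zD))/allP/(_ _ (off _ wD)); rewrite inc => /allP h.
by apply/eqP/h; rewrite !inE eqxx.
Qed.

End one_side.

(** Sending [x] to the only rectangle that misses it is injective, by
    incomparability, hence onto. *)
Lemma all_triples_missing (T : finType) (RT : 'I_4 -> {set T}) (D : {set T}) :
    (4 <= #|D|)%N ->
    (forall x y, x \in D -> y \in D -> x != y ->
       exists i, x \in RT i /\ y \notin RT i) ->
    (forall x, x \in D -> count_mem true (rects RT x) = 3%N) ->
  forall i, exists2 x, x \in D & forall j, (x \in RT j) = (j != i).
Proof.
move=> D4 anti tri.
have miss x : x \in D -> exists i, forall j, (x \in RT j) = (j != i).
  move=> /tri; rewrite /rects /=; case: (boolP (x \in RT i0)) => x0;
  case: (boolP (x \in RT i1)) => x1; case: (boolP (x \in RT i2)) => x2;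
  case: (boolP (x \in RT i3)) => x3 // _;
  [exists i3|exists i2|exists i1|exists i0]; apply: I4P;
  by rewrite ?x0 ?x1 ?x2 ?x3 ?(negbTE x0) ?(negbTE x1) ?(negbTE x2) ?(negbTE x3).
pose f x : 'I_4 := odflt i0 [pick i | x \notin RT i].
have fP x : x \in D -> forall j, (x \in RT j) = (j != f x).
  move=> /miss[i xi] j; rewrite /f; case: pickP => [k|/(_ i)] /=.
    by rewrite !xi negbK => /eqP->.
  by rewrite xi eqxx.
have fI : {in D &, injective f}.
  move=> x y xD yD fxy; apply/eqP; apply: contraT => xy.
  have [i [xi]] := anti _ _ xD yD xy.
  by rewrite fP // -fxy -fP // xi.
move=> i; have fD : f @: D = [set: 'I_4].
  by apply/eqP; rewrite eqEcard subsetT cardsT card_ord card_in_imset.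
have : i \in f @: D by rewrite fD inE.
by case/imsetP => x xD ->; exists x => // j; exact: fP.
Qed.

Lemma count_rects (T : finType) (RT : 'I_4 -> {set T}) x :
  count_mem true (rects RT x) = #|[set i | x \in RT i]|.
Proof.
rewrite -sum1_card big_mkcond !big_ord_recl big_ord0 !inE /rects /=.
have e (i j : 'I_4) : i = j :> nat -> (x \in RT i) = (x \in RT j).
  by move=> /val_inj->.
rewrite (e ord0 i0) // (e (lift ord0 ord0) i1) //.
rewrite (e (lift ord0 (lift ord0 ord0)) i2) //.
rewrite (e (lift ord0 (lift ord0 (lift ord0 ord0))) i3) //.
by do 4![case: (_ \in _)].
Qed.

Lemma two_others (i j : 'I_4) : (i < j)%N -> exists u v,
  [/\ i != v, v != j & forall w, w != u -> w \in [:: i; v; j]].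
Proof.
case: i j => [[|[|[|[|//]]]] ?] [[|[|[|[|//]]]] ?] // _.
- by exists i3, i2; split=> //; apply: I4P.
- by exists i3, i1; split=> //; apply: I4P.
- by exists i2, i1; split=> //; apply: I4P.
- by exists i3, i0; split=> //; apply: I4P.
- by exists i2, i0; split=> //; apply: I4P.
- by exists i1, i0; split=> //; apply: I4P.
Qed.

(** Suppose that every column misses exactly one rectangle. If any two
    rectangles have a common row, then the common row of the first two is a
    column potential for all four: a column lies in one of the first two
    rectangles, and it is compared there with a column [q] that lies in both. If
    instead rectangles [i] and [j] have no common row, then every row lies in
    exactly two rectangles and two rectangles share at most one row, so the
    rectangles of a column that lies in [i] and [j] form a forest, which the last
    hypothesis excludes. *)
Lemma liftable_all_triples M RP RQ (A : {set P}) (B : {set Q}) :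
    balanced M RP RQ -> (forall i, RP i \subset A) ->
    (forall i, RQ i \subset B) ->
    (4 <= #|A|)%N -> (4 <= #|B|)%N ->
    (forall x y, x \in A -> y \in A -> x != y ->
       exists i, x \in RP i /\ y \notin RP i) ->
    (forall x, x \in A -> rects RP x \in medium4) ->
    (forall x y, x \in B -> y \in B -> x != y ->
       exists i, x \in RQ i /\ y \notin RQ i) ->
    (forall x, x \in B -> count_mem true (rects RQ x) = 3%N) ->
    (forall n (l : seq 'I_4), n \in B -> (forall i, n \in RQ i -> i \in l) ->
       ~~ forest RP l) ->
  liftable M RP RQ.
Proof.
move=> bM RPA RQB A4 B4 antiA medA antiB triB noforest.
have miss := all_triples_missing B4 antiB triB.
have pt : forall i j : 'I_4, (i < j)%N -> exists2 m, m \in RP i & m \in RP j.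
  move=> i j ij; have ijp : (i : nat, j : nat) \in pairs4.
    by case: i j ij => [[|[|[|[|//]]]] ?] [[|[|[|[|//]]]] ?].
  case: (boolP [exists m in A, pair4 (rects RP m) (i : nat, j : nat)]).
    move=> /existsP[m /and3P[mA]]; rewrite /= !rects_nth => mi mj.
    by exists m.
  move=> /existsPn nop.
  have card2 : forall m, m \in A -> count_mem true (rects RP m) = 2%N.
    apply: (all_pairs A4 antiA medA ijp) => m mA.
    by have := nop m; rewrite mA.
  have le1 k l : k != l -> (#|RP k :&: RP l| <= 1)%N.
    move=> kl; apply/card_le1_eqP => x y; rewrite !inE => /andP[xk xl] /andP[yk yl].
    apply/eqP; apply: contraT; rewrite eq_sym => xy.
    have xA := subsetP (RPA k) _ xk; have yA := subsetP (RPA k) _ yk.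
    have rectsE z : z \in A -> z \in RP k -> z \in RP l ->
        [set h | z \in RP h] = [set k; l].
      move=> zA zk zl; apply/esym/eqP.
      rewrite eqEcard -count_rects card2 // cards2 kl leqnn andbT.
      by apply/subsetP => h; rewrite !inE => /orP[]/eqP->.
    have [h [xh yh]] := antiA _ _ xA yA xy.
    have : h \in [set h | x \in RP h] by rewrite inE.
    by rewrite rectsE // -(rectsE y) // inE (negbTE yh).
  have nij : RP i :&: RP j = set0.
    apply/eqP; rewrite -subset0; apply/subsetP => x; rewrite !inE => /andP[xi xj].
    have := nop x; rewrite (subsetP (RPA i) _ xi) /= /pair4 !rects_nth.
    by rewrite xi xj.
  have [u [v [iv vj uijv]]] := two_others ij.
  have [n nB nu] := miss u.
  have nij_v w : n \in RQ w -> w \in [:: i; v; j] by rewrite nu; exact: uijv.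
  move: (noforest n _ nB nij_v) => /negP; case.
  rewrite /= !big_cons big_nil !setU0 setI0 cards0 /= le1 //=.
  by rewrite setIUr nij setU0 le1.
have [r01 r01_0 r01_1] := pt i0 i1 isT.
have [r02 r02_0 r02_2] := pt i0 i2 isT.
have [r03 r03_0 r03_3] := pt i0 i3 isT.
have [r12 r12_1 r12_2] := pt i1 i2 isT.
have [r13 r13_1 r13_3] := pt i1 i3 isT.
apply: (@liftable_potential _ _ _ M RP RQ (M r01)).
have same i r s n n' : r \in RP i -> s \in RP i -> n \in RQ i -> n' \in RQ i ->
    M r n (+) M r n' = M s n (+) M s n'.
  move=> ri si ni n'i; have := bM i r s n n' ri si ni n'i.
  by case: (M r n) (M s n) (M r n') (M s n') => [] [] [] [].
have in01 n : n \in B -> n \notin RQ i0 -> n \in RQ i1.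
  move=> nB n0; have := triB _ nB; rewrite /rects /= (negbTE n0).
  by case: (n \in RQ i1) => //; case: (_ \in _) => //; case: (_ \in _).
(* [r0] and [r1] are the rows that rectangle [i] shares with rectangles 0 and 1. *)
have pivot i r0 r1 q : r0 \in RP i0 -> r1 \in RP i1 -> r0 \in RP i ->
    r1 \in RP i -> q \in RQ i0 -> q \in RQ i1 -> q \in RQ i ->
    forall m n, m \in RP i -> n \in RQ i -> M m n (+) M m q = M r01 n (+) M r01 q.
  move=> r0_0 r1_1 r0_i r1_i q0 q1 qi m n mi ni.
  have [n0|n0] := boolP (n \in RQ i0).
    by rewrite (same i m r0) // (same i0 r0 r01).
  have n1 := in01 n (subsetP (RQB i) _ ni) n0.
  by rewrite (same i m r1) // (same i1 r1 r01).
have pivot2 i r0 r1 q : r0 \in RP i0 -> r1 \in RP i1 -> r0 \in RP i ->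
    r1 \in RP i -> q \in RQ i0 -> q \in RQ i1 -> q \in RQ i ->
    forall m n n', m \in RP i -> n \in RQ i -> n' \in RQ i ->
    M m n (+) M m n' = M r01 n (+) M r01 n'.
  move=> h1 h2 h3 h4 h5 h6 h7 m n n' mi ni n'i.
  have e := pivot i r0 r1 q h1 h2 h3 h4 h5 h6 h7 m n mi ni.
  have e' := pivot i r0 r1 q h1 h2 h3 h4 h5 h6 h7 m n' mi n'i.
  by move: e e'; case: (M m n) (M m q) (M m n') (M r01 n) (M r01 q) (M r01 n')
    => [] [] [] [] [] [].
refine (@I4P (fun i => forall m n n', m \in RP i -> n \in RQ i ->
  n' \in RQ i -> M m n (+) M m n' = M r01 n (+) M r01 n') _ _ _ _)
  => m n n' mi ni n'i.
- exact: (same i0).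
- exact: (same i1).
- have [q _ qP] := miss i3.
  by apply: (pivot2 i2 r02 r12 q) => //; rewrite qP.
- have [q _ qP] := miss i2.
  by apply: (pivot2 i3 r03 r13 q) => //; rewrite qP.
Qed.

(** At most one rectangle is a forest, and a row that lies in all four rectangles
    dominates all other rows. *)
Lemma irreducible_medium (T U : finType) (RT : 'I_4 -> {set T})
    (RU : 'I_4 -> {set U}) (D : {set T}) : (4 <= #|D|)%N ->
    (forall x y, x \in D -> y \in D -> x != y ->
       exists i, x \in RT i /\ y \notin RT i) ->
    (forall x (l : seq 'I_4), x \in D -> (forall i, x \in RT i -> i \in l) ->
       ~~ forest RU l) ->
  forall x, x \in D -> rects RT x \in medium4.
Proof.
move=> D4 anti nof x xD; rewrite mem_filter andbC; apply/andP; split.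
  rewrite /rects.
  by case: (x \in RT i0) (x \in RT i1) (x \in RT i2) (x \in RT i3) => [] [] [] [].
rewrite count_rects; apply/andP; split.
  rewrite ltnNge; apply/negP => c1.
  have /negP := nof x (enum [set i | x \in RT i]) xD
    (fun i xi => etrans (mem_enum _ i) (etrans (in_set _ i) xi)).
  apply; move: c1; rewrite cardE; case: (enum _) => [|i []] //= _.
  by rewrite big_nil setI0 cards0.
have [y yD yx] : exists2 y, y \in D & y != x.
  have /card_gt1P[y [z [yD zD yz]]] : (1 < #|D|)%N by apply: leq_trans D4.
  by case: (eqVneq y x) yz => [->|yx _]; [exists z; rewrite // eq_sym|exists y].
have [i [yi xi]] := anti _ _ yD xD yx.
rewrite -[X in (_ < X)%N](card_ord 4) -cardsT; apply: proper_card.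
by apply/properP; split; [exact: subsetT | exists i; rewrite !inE].
Qed.

End four_rectangles.

(** Remove rows and columns by [liftable_dominated] and [liftable_forest] as long
    as possible; up to three rows or columns are settled by [liftable_few_rows].
    If at least four rows and four columns are left and some row
    lies in exactly two rectangles, these are not a forest, so two columns lie
    in both of them, and then every column lies in three rectangles. Otherwise
    every row lies in three rectangles. *)
Lemma liftable_four (P Q : finType) n (M : P -> Q -> bool)
    (RP : 'I_4 -> {set P}) (RQ : 'I_4 -> {set Q}) (A : {set P}) (B : {set Q}) :
    (#|A| + #|B| <= n)%N -> balanced M RP RQ ->
    (forall i, RP i \subset A) -> (forall i, RQ i \subset B) ->
  liftable M RP RQ.
Proof.
elim: n M RP RQ A B => [|n IH] M RP RQ A B ABn bM RPA RQB.
  have A3 : (#|A| <= 3)%N by lia.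
  by case: (liftable_few_rows bM RPA RQB A3) => [//|[]]; lia.
case: (leqP #|A| 3) => A4.
  by case: (liftable_few_rows bM RPA RQB A4) => [//|[_ _]]; rewrite card_ord.
case: (leqP #|B| 3) => B4.
  apply: liftable_transpose.
  case: (liftable_few_rows (balanced_transpose bM) RQB RPA B4) => [//|[_ _]].
  by rewrite card_ord.
have IHrow m : m \in A -> liftable M (fun i => RP i :\ m) RQ.
  move=> mA; apply: (IH _ _ _ (A :\ m) B) => //.
  - by have := cardsD1 m A; rewrite mA; lia.
  - move=> i x x' y y'; rewrite !inE => /andP[_ xi] /andP[_ x'i]; exact: (bM i).
  - by move=> i; apply: setSD.
have IHcol k : k \in B -> liftable (fun n m => M m n) (fun i => RQ i :\ k) RP.
  move=> kB; apply: liftable_transpose; apply: (IH _ _ _ A (B :\ k)) => //.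
  - by have := cardsD1 k B; rewrite kB; lia.
  - move=> i x x' y y' xi x'i; rewrite !inE => /andP[_ yi] /andP[_ y'i]; exact: (bM i).
  - by move=> i; apply: setSD.
have [//|nl] := pselect (liftable M RP RQ); exfalso.
have noforestA m l : m \in A -> (forall i, m \in RP i -> i \in l) -> ~~ forest RQ l.
  move=> mA ml; apply/negP => fl; apply: nl.
  exact: liftable_forest ml fl (IHrow _ mA).
have noforestB k l : k \in B -> (forall i, k \in RQ i -> i \in l) -> ~~ forest RP l.
  move=> kB kl; apply/negP => fl; apply: nl; apply: liftable_transpose.
  exact: liftable_forest (balanced_transpose bM) kl fl (IHcol _ kB).
have antiA x y : x \in A -> y \in A -> x != y -> exists i, x \in RP i /\ y \notin RP i.
  move=> xA yA xy.
  case: (boolP [exists i, (x \in RP i) && (y \notin RP i)]) => [/existsP[i /andP[]]|].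
    by exists i.
  move=> /existsPn dom; exfalso; apply: nl.
  apply: (@liftable_dominated _ _ _ _ _ _ x y) => //; last exact: IHrow.
    by rewrite eq_sym.
  by move=> i xi; have := dom i; rewrite xi negbK.
have antiB x y : x \in B -> y \in B -> x != y -> exists i, x \in RQ i /\ y \notin RQ i.
  move=> xB yB xy.
  case: (boolP [exists i, (x \in RQ i) && (y \notin RQ i)]) => [/existsP[i /andP[]]|].
    by exists i.
  move=> /existsPn dom; exfalso; apply: nl; apply: liftable_transpose.
  apply: (@liftable_dominated _ _ _ _ _ _ x y) => //; last exact: IHcol.
  - exact: balanced_transpose.
  - by rewrite eq_sym.
  by move=> i xi; have := dom i; rewrite xi negbK.
have medA := irreducible_medium A4 antiA noforestA.
have medB := irreducible_medium B4 antiB noforestB.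
have [/existsP[m /andP[mA /eqP m2]]|no2] :=
    boolP [exists m in A, count_mem true (rects RP m) == 2%N].
  have /cards2P[i [j [ij Im]]] : #|[set i | m \in RP i]| == 2%N.
    by rewrite -count_rects m2.
  apply: nl.
  have : ~~ forest RQ [:: i; j].
    apply: (noforestA m) => // h mh.
    have : h \in [set i | m \in RP i] by rewrite inE.
    by rewrite Im !inE.
  rewrite /= !big_cons big_nil !setU0 setI0 cards0 /= -ltnNge.
  move=> /card_gt1P[x [y [xij yij xy]]].
  move: xij yij; rewrite !inE => /andP[xi xj] /andP[yi yj].
  have [xB yB] : x \in B /\ y \in B by rewrite !(subsetP (RQB i)).
  have [kl klp [xkl ykl]] : exists2 kl, kl \in pairs4 &
      pair4 (rects RQ x) kl /\ pair4 (rects RQ y) kl.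
    case: (ltngtP i j) => [lt|lt|/val_inj e]; last by rewrite e eqxx in ij.
      exists (i : nat, j : nat); rewrite /pair4 /= ?rects_nth ?xi ?xj ?yi ?yj //.
      by move: lt; clear; case: i j => [[|[|[|[|//]]]] ?] [[|[|[|[|//]]]] ?].
    exists (j : nat, i : nat); rewrite /pair4 /= ?rects_nth ?xi ?xj ?yi ?yj //.
    by move: lt; clear; case: i j => [[|[|[|[|//]]]] ?] [[|[|[|[|//]]]] ?].
  have triB := all_triples B4 antiB medB klp xB yB xy xkl ykl.
  exact: (liftable_all_triples bM RPA RQB).
have triA x : x \in A -> count_mem true (rects RP x) = 3%N.
  move=> xA; move/existsPn: no2 => /(_ x); rewrite xA andTb => /eqP.
  have := medA _ xA; rewrite mem_filter => /andP[/andP[]].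
  by move: (count_mem _ _) => c; lia.
apply: nl; apply: liftable_transpose.
exact: (liftable_all_triples (balanced_transpose bM) RQB RPA B4 A4 antiB medB
  antiA triA noforestA).
Qed.


(** An obstruction with at most three rows, or columns, takes thirteen points;
    four rows and four columns leave room for only four rectangles. *)
Lemma liftable_twelve (P Q I : finType) (M : P -> Q -> bool)
    (RP : I -> {set P}) (RQ : I -> {set Q}) :
    (#|P| + #|Q| + #|I| <= 12)%N -> balanced M RP RQ -> liftable M RP RQ.
Proof.
move=> PQI bM.
have RPT i : RP i \subset [set: P] by apply: subsetT.
have RQT i : RQ i \subset [set: Q] by apply: subsetT.
have [P3|P4] := leqP #|P| 3.
  case: (@liftable_few_rows _ _ _ _ _ _ [set: P] [set: Q] bM) => //; rewrite ?cardsT //.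
  by case=> *; lia.
have [Q3|Q4] := leqP #|Q| 3.
  apply: liftable_transpose.
  case: (@liftable_few_rows _ _ _ _ _ _ [set: Q] [set: P] (balanced_transpose bM)) => //;
    rewrite ?cardsT //.
  by case=> *; lia.
have I4 : (#|I| <= 4)%N by lia.
pose RT (T : finType) (RT : I -> {set T}) (k : 'I_4) :=
  if insub (k : nat) is Some j then RT (enum_val (j : 'I_#|I|)) else set0.
have RTI (T : finType) (S : I -> {set T}) i : S i = RT T S (widen_ord I4 (enum_rank i)).
  by rewrite /RT /= valK enum_rankK.
have bR : balanced M (RT _ RP) (RT _ RQ).
  rewrite /RT => k m m' n n'; case: (insub _) => [j|]; last by rewrite inE.
  exact: bM.
have [c [cM cR]] := @liftable_four _ _ _ M (RT _ RP) (RT _ RQ) setT setT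
  (leqnn _) bR (fun i => subsetT _) (fun i => subsetT _).
by exists c; split=> // i; rewrite !(RTI _ _ i); exact: cR.
Qed.

(** * Integral lifts of mod 2 cocycles on a finite preorder *)

Section minimal_representatives.
Variables (X : finType) (le : rel X).
Hypotheses (le_refl : reflexive le) (le_trans : transitive le).

(** A minimal point, chosen in its equivalence class as the first one in the
    enumeration: in a preorder that is not an order, only one point of the class
    should count as a row. *)
Definition min_rep (m : X) := [forall y, le y m ==> le m y && (enum_rank m <= enum_rank y)%N].
Definition max_rep (n : X) := [forall y, le n y ==> le y n && (enum_rank n <= enum_rank y)%N].

Lemma rank_antisym (x y : X) :
  (enum_rank x <= enum_rank y)%N -> (enum_rank y <= enum_rank x)%N -> x = y.
Proof.
by move=> xy yx; apply/enum_rank_inj/val_inj/eqP; rewrite eqn_leq xy yx.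
Qed.

Lemma min_rep_inj m m' : min_rep m -> min_rep m' -> le m m' -> m = m'.
Proof.
move=> /forallP mM /forallP m'M mm'.
have := m'M m; rewrite mm' /= => /andP[m'm rm'].
by have := mM m'; rewrite m'm /= => /andP[_]; move=> rm; exact: rank_antisym.
Qed.

Lemma max_rep_inj n n' : max_rep n -> max_rep n' -> le n n' -> n = n'.
Proof.
move=> /forallP nM /forallP n'M nn'.
have := nM n'; rewrite nn' /= => /andP[n'n rn].
by have := n'M n; rewrite n'n /= => /andP[_]; move=> rn'; exact: rank_antisym.
Qed.

Lemma min_rep_below x : exists2 m, min_rep m & le m x.
Proof.
pose down y := [set z | le z y].
(* First a minimal point [y] below [x], then the first point of its class. *)
have [y yx ymin] := @arg_minnP _ x (fun y => le y x) (fun y => #|down y|) (le_refl x).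
have [m my mmin] := @arg_minnP _ y (fun z => le z y) (fun z => enum_rank z) (le_refl y).
exists m; last exact: le_trans yx.
apply/forallP => z; apply/implyP => zm; have zy := le_trans zm my.
rewrite mmin // andbT; apply: (le_trans my).
apply: contraT => nyz; have := ymin z (le_trans zy yx).
rewrite leqNgt => /negP; case; apply: proper_card; apply/properP; split.
  by apply/subsetP => w; rewrite !inE => /le_trans; exact.
by exists y; rewrite !inE.
Qed.

End minimal_representatives.

Section preorder_cocycles.
Variables (X : finType) (le : rel X).
Hypotheses (le_refl : reflexive le) (le_trans : transitive le).

Lemma max_rep_above x : exists2 n, max_rep le n & le x n.
Proof.
apply: (@min_rep_below _ (fun x y => le y x)) => // y z w zy yw.
exact: le_trans yw zy.
Qed.

Variable s : X -> X -> bool.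
Hypothesis sD : forall x y z, le x y -> le y z -> s x y (+) s y z = s x z.

(** Rows are minimal representatives, columns maximal ones that are not already
    rows, and every other point [x] gives the rectangle of the rows below and
    columns above it. A lift on pairs (row, column) extends to pairs [m <= x]
    with [m] a row ([kappa]) by going up to a column above [x] and back. The
    value [kappa m y - kappa m x] on [x <= y] does not depend on the row [m]
    below [x], exactly because the rectangle of [x] is balanced. *)
Lemma integral_cocycle : (#|X| <= 12)%N -> exists c : X -> X -> int,
  (forall x y, le x y -> oddz (c x y) = s x y) /\
  (forall x y z, le x y -> le y z -> c x y + c y z = c x z).
Proof.
move=> X12.
pose isP := min_rep le; pose isQ x := max_rep le x && ~~ isP x.
pose P := {x : X | isP x}; pose Q := {x : X | isQ x}.
pose I := {x : X | ~~ isP x && ~~ isQ x}.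
pose RP x : {set P} := [set m | le (val m) x].
pose RQ x : {set Q} := [set n | le x (val n)].
pose M (m : P) (n : Q) := s (val m) (val n).
have bM : balanced M (fun i : I => RP (val i)) (fun i : I => RQ (val i)).
  move=> i m m' n n'; rewrite !inE /M => mi m'i ni n'i.
  rewrite -(sD mi ni) -(sD mi n'i) -(sD m'i ni) -(sD m'i n'i).
  move: (s _ _) (s _ _) (s _ _) (s _ _) => b1 b2 b3 b4.
  by case: b1 b2 b3 b4 => [] [] [] [].
have card_PQI : (#|{: P}| + #|{: Q}| + #|{: I}| <= 12)%N.
  rewrite !card_sig; apply: leq_trans X12; rewrite -(cardC isP) -addnA leq_add2l.
  rewrite -(cardID isQ (predC isP)) leq_add //; apply: subset_leq_card;
  apply/subsetP => x; rewrite !unfold_in /=.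
    by move=> /andP[-> ->].
  by rewrite andbC.
have [c [cM cR]] := liftable_twelve card_PQI bM.
have rect x (m m' : P) (n n' : Q) : m \in RP x -> m' \in RP x ->
    n \in RQ x -> n' \in RQ x -> c m n - c m' n = c m n' - c m' n'.
  case: (boolP (isP x)) => [xP|xP].
    rewrite !inE => mx m'x _ _; rewrite (_ : m = m') ?subrr //.
    apply: val_inj; rewrite (min_rep_inj (valP m) xP mx).
    by rewrite (min_rep_inj (valP m') xP m'x).
  case: (boolP (isQ x)) => [xQ|xQ].
    rewrite !inE => _ _ xn xn'; rewrite (_ : n = n') //.
    have [mx _] := andP xQ.
    apply: val_inj; have /andP[nQ _] := valP n; have /andP[n'Q _] := valP n'.
    by rewrite -(max_rep_inj mx nQ xn) -(max_rep_inj mx n'Q xn').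
  have xI : ~~ isP x && ~~ isQ x by rewrite xP xQ.
  exact: (cR (exist _ x xI)).
pose kappa (m : P) x : int := if [pick n in RQ x] is Some n
  then c m n - (s x (val n) : nat)%:Z else (s (val m) x : nat)%:Z.
have kappaP m x : m \in RP x -> oddz (kappa m x) = s (val m) x.
  rewrite inE => mx; rewrite /kappa; case: pickP => [n|_]; last exact: oddzb.
  rewrite inE => xn; rewrite oddzB oddzb cM /M -(sD mx xn).
  by rewrite -addbA addbb addbF.
have indep x y (m m' : P) : le x y -> m \in RP x -> m' \in RP x ->
    kappa m y - kappa m x = kappa m' y - kappa m' x.
  move=> xy mx m'x.
  have [t tmax yt] := max_rep_above y.
  rewrite {2 4}/kappa; case: pickP => [nx nxx|nox]; last first.
    have tP : isP t.
      apply: contraT => tP; have tQ : isQ t by rewrite /isQ tmax tP.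
      have := nox (exist _ t tQ : Q); rewrite inE /=.
      by rewrite (le_trans xy yt).
    suff -> : m = m' by [].
    move: mx m'x; rewrite !inE => mx m'x.
    have xt := le_trans xy yt; apply: val_inj.
    rewrite (min_rep_inj (valP m) tP (le_trans mx xt)).
    by rewrite (min_rep_inj (valP m') tP (le_trans m'x xt)).
  rewrite /kappa; case: pickP => [ny|noy]; last first.
    have tP : isP t.
      apply: contraT => tP; have tQ : isQ t by rewrite /isQ tmax tP.
      by have := noy (exist _ t tQ : Q); rewrite inE /= yt.
    have [/andP[nxmax nxP]] := valP nx; move: nxx; rewrite inE => xnx.
    have xt := le_trans xy yt.
    have /forallP/(_ x) := tP; rewrite xt /= => /andP[tx _].
    by rewrite -(max_rep_inj tmax nxmax (le_trans tx xnx)) tP in nxP.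
  rewrite inE => yny; have nyx : ny \in RQ x by rewrite inE (le_trans xy yny).
  by have := rect x m m' nx ny mx m'x nxx nyx; lia.
have belowP x : exists m : P, m \in RP x.
  have [m mP mx] := min_rep_below le_refl le_trans x.
  by exists (exist _ m mP); rewrite inE.
pose below x := xchoose (belowP x).
have belowx x : below x \in RP x := xchooseP (belowP x).
have RPle x y : le x y -> {subset RP x <= RP y}.
  by move=> xy m; rewrite !inE => /le_trans; exact.
exists (fun x y => kappa (below x) y - kappa (below x) x); split=> [x y xy|].
  rewrite oddzB !kappaP ?(RPle _ _ xy) //.
  have := belowx x; rewrite inE => /sD/(_ xy)<-.
  by rewrite addbC addbA addbb.
move=> x y z xy yz.
rewrite (indep y z (below y) (below x)) // ?(RPle _ _ xy) //.
lia.
Qed.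

End preorder_cocycles.

(* From here on [set0], [setT], [subsetP] and the like refer to classical sets;
   above they refer to finite sets. *)
From mathcomp Require Import all_classical all_reals all_analysis.

Import numFieldNormedType.Exports.

Local Open Scope classical_set_scope.
Local Open Scope quotient_scope.

(** * The fundamental groupoid *)

Section continuity.
Context {R : realType} {T : topologicalType}.
Implicit Types f g : T -> R.

Lemma cts_comp (U V : topologicalType) (f : T -> U) (g : U -> V) :
  continuous f -> continuous g -> continuous (fun x => g (f x)).
Proof. by move=> cf cg x; apply: continuous_comp; [exact: cf | exact: cg]. Qed.

Lemma cts_pair (U V : topologicalType) (f : T -> U) (g : T -> V) :
  continuous f -> continuous g -> continuous (fun x => (f x, g x)).
Proof. by move=> cf cg x; exact: (cvg_pair (cf x) (cg x)). Qed.

Lemma cts_cst (U : topologicalType) (u : U) : continuous (fun _ : T => u).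
Proof. by move=> x; exact: cvg_cst. Qed.

Lemma cts_id : continuous (fun x : T => x).
Proof. by move=> x; exact: cvg_id. Qed.

Lemma cts_add f g : continuous f -> continuous g -> continuous (fun x => f x + g x).
Proof. by move=> cf cg x; apply: cvgD; [exact: cf | exact: cg]. Qed.

Lemma cts_opp f : continuous f -> continuous (fun x => - f x).
Proof. by move=> cf x; apply: cvgN; exact: cf. Qed.

Lemma cts_mul f g : continuous f -> continuous g -> continuous (fun x => f x * g x).
Proof. by move=> cf cg x; apply: cvgM; [exact: cf | exact: cg]. Qed.

Lemma cts_fst (U V : topologicalType) (f : T -> U * V) :
  continuous f -> continuous (fun x => (f x).1).
Proof. by move=> cf; apply: (cts_comp (g := fst) cf) => -[a b]; exact: cvg_fst. Qed.

Lemma cts_snd (U V : topologicalType) (f : T -> U * V) :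
  continuous f -> continuous (fun x => (f x).2).
Proof. by move=> cf; apply: (cts_comp (g := snd) cf) => -[a b]; exact: cvg_snd. Qed.

(** Gluing along the closed sets where [phi] is nonpositive and nonnegative. *)
Lemma cts_glue (U : topologicalType) (phi : T -> R) (f g : T -> U) :
    continuous phi -> continuous f -> continuous g ->
    (forall x, phi x = 0 -> f x = g x) ->
  continuous (fun x => if phi x <= 0 then f x else g x).
Proof.
move=> cphi cf cg fg x W /= nW.
have [x0|x0|x0] := ltgtP (phi x) 0.
- have nx : nbhs x [set y | phi y < 0] by exact: (cphi x _ (lt_nbhsl x0)).
  have nf : nbhs x [set y | W (f y)] by apply: (cf x); move: nW; rewrite /= (ltW x0).
  by apply: filterS2 nx nf => y /= /ltW->.
- have nx : nbhs x [set y | 0 < phi y] by exact: (cphi x _ (lt_nbhsr x0)).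
  have ng : nbhs x [set y | W (g y)] by apply: (cg x); move: nW; rewrite leNgt x0.
  by apply: filterS2 nx ng => y /= y0; rewrite leNgt y0.
have nf : nbhs x [set y | W (f y)] by apply: (cf x); move: nW; rewrite x0 lexx.
have ng : nbhs x [set y | W (g y)].
  by apply: (cg x); rewrite -fg //; move: nW; rewrite x0 lexx.
by apply: filterS2 nf ng => y /= Wf Wg; case: ifP.
Qed.

End continuity.

Ltac cts := repeat first
  [ assumption | exact (@cts_id _) | exact (@cts_cst _ _ _)
  | refine (cts_add _ _) | refine (cts_opp _) | refine (cts_mul _ _)
  | refine (cts_pair _ _) | refine (cts_fst _) | refine (cts_snd _) ].

Section paths.
Context {R : realType} {X : topologicalType}.
Implicit Types (x y z : X) (g h k : R -> X).

(** Paths are functions on the whole line that are constant outside the unit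
    interval. This makes composition with any reparametrization meaningful. *)
Definition is_path x y g :=
  [/\ continuous g, forall s, s <= 0 -> g s = x & forall s, 1 <= s -> g s = y].

(** The first coordinate is the time of the homotopy, the second one the
    parameter of the paths. *)
Definition path_homotopic x y g h := exists H : R * R -> X,
  [/\ continuous H, forall s, H (0, s) = g s, forall s, H (1, s) = h s &
      forall t, is_path x y (fun s => H (t, s))].

Definition path x y := {g : R -> X | `[< is_path x y g >]}.

Lemma path_homotopic_refl x y g : is_path x y g -> path_homotopic x y g g.
Proof.
move=> [cg g0 g1]; exists (fun p => g p.2); split=> [|//|//|t]; last by split.
by apply: (cts_comp _ cg); cts.
Qed.

Lemma path_homotopic_sym x y g h : path_homotopic x y g h -> path_homotopic x y h g.
Proof.
move=> [H [cH H0 H1 Hxy]]; exists (fun p => H (1 - p.1, p.2)); split=> [|s|s|t] /=.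
- by apply: (cts_comp _ cH); cts.
- by rewrite subr0.
- by rewrite subrr.
exact: Hxy.
Qed.

Lemma path_homotopic_trans x y g h k :
  path_homotopic x y g h -> path_homotopic x y h k -> path_homotopic x y g k.
Proof.
move=> [H [cH H0 H1 Hxy]] [K [cK K0 K1 Kxy]].
exists (fun p => if p.1 - 2^-1 <= 0 then H (2 * p.1, p.2) else K (2 * p.1 - 1, p.2)).
split=> [|s|s|t] /=.
- refine (cts_glue (phi := fun p : R * R => p.1 - 2^-1)
    (f := fun p => H (2 * p.1, p.2)) (g := fun p => K (2 * p.1 - 1, p.2)) _ _ _ _);
    [by cts|by apply: (cts_comp _ cH); cts
    |by apply: (cts_comp _ cK); cts|].
  move=> [t s] /= t2; have -> : 2 * t = 1 by lra.
  by rewrite subrr H1 K0.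
- have -> : 0 - 2^-1 <= 0 :> R by lra.
  by rewrite mulr0 H0.
- have -> : (1 - 2^-1 <= 0 :> R) = false by lra.
  by have -> : 2 * 1 - 1 = 1 :> R by lra.
by case: (t - 2^-1 <= 0); [exact: Hxy | exact: Kxy].
Qed.

Definition path_rel x y : rel (path x y) := fun p q =>
  `[< path_homotopic x y (val p) (val q) >].

Lemma path_rel_refl x y : reflexive (@path_rel x y).
Proof. by move=> p; apply/asboolP/path_homotopic_refl/asboolP/(valP p). Qed.

Lemma path_rel_sym x y : symmetric (@path_rel x y).
Proof. by move=> p q; apply/asboolP/asboolP; exact: path_homotopic_sym. Qed.

Lemma path_rel_trans x y : transitive (@path_rel x y).
Proof.
by move=> q p r /asboolP pq /asboolP qr; apply/asboolP; exact: path_homotopic_trans qr.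
Qed.

Canonical path_rel_equiv x y := EquivRel (@path_rel x y)
  (@path_rel_refl x y) (@path_rel_sym x y) (@path_rel_trans x y).

Definition Pi x y := {eq_quot path_rel_equiv x y}.
End paths.

Section classes.
Context {R : realType} {X : topologicalType}.
Implicit Types (x y z w : X) (g h k l : R -> X).
Local Notation is_path := (@is_path R X).
Local Notation path_homotopic := (@path_homotopic R X).
Local Notation Pi := (@Pi R X).

Definition clamp (s : R) : R := if s <= 0 then 0 else if s - 1 <= 0 then s else 1.

Lemma clamp_cts : continuous clamp.
Proof.
apply: (@cts_glue R R R (fun s => s) (fun _ => 0)
  (fun s => if s - 1 <= 0 then s else 1)); [by cts | by cts | | ].
  apply: (@cts_glue R R R (fun s => s - 1) (fun s => s) (fun _ => 1)); [by cts..|].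
  by move=> s s1; lra.
by move=> s ->; have -> : 0 - 1 <= 0 :> R by lra.
Qed.

Lemma clamp_le0 s : s <= 0 -> clamp s = 0.
Proof. by rewrite /clamp => ->. Qed.

Lemma clamp_ge1 s : 1 <= s -> clamp s = 1.
Proof.
move=> s1; rewrite /clamp; have -> : (s <= 0) = false by lra.
by case: ifP => // ?; lra.
Qed.

Lemma clamp_id s : 0 <= s <= 1 -> clamp s = s.
Proof.
move=> s01; rewrite /clamp; case: ifP => [?|_]; first lra.
by have -> : s - 1 <= 0 by lra.
Qed.

Lemma clamp01 s : 0 <= clamp s <= 1.
Proof.
rewrite /clamp; case: (leP s 0) => s0; first by rewrite lexx ler01.
by case: ifP => s1; rewrite ?ler01 ?lexx //; lra.
Qed.

Lemma path_clamp x y g s : is_path x y g -> g (clamp s) = g s.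
Proof.
move=> [_ g0 g1]; have [s0|s0] := leP s 0.
  by rewrite clamp_le0 // !g0.
have [s1|s1] := leP 1 s; first by rewrite clamp_ge1 // !g1.
by rewrite clamp_id //; lra.
Qed.

(** Two reparametrizations of one curve with the same ends are homotopic, since
    the line is convex. All laws of the fundamental groupoid are instances. *)
Lemma path_homotopic_param x y (gamma : R -> X) k l (phi psi : R -> R) :
    continuous gamma -> continuous phi -> continuous psi ->
    is_path x y k -> is_path x y l ->
    phi 0 = psi 0 -> phi 1 = psi 1 ->
    (forall s, 0 <= s <= 1 -> k s = gamma (phi s)) ->
    (forall s, 0 <= s <= 1 -> l s = gamma (psi s)) ->
  path_homotopic x y k l.
Proof.
move=> cg cphi cpsi pk pl e0 e1 kE lE.
exists (fun p => gamma ((1 - p.1) * phi (clamp p.2) + p.1 * psi (clamp p.2))).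
have cphic : continuous (fun p : R * R => phi (clamp p.2)).
  apply: (cts_comp _ cphi); apply: (cts_comp _ clamp_cts); cts.
have cpsic : continuous (fun p : R * R => psi (clamp p.2)).
  apply: (cts_comp _ cpsi); apply: (cts_comp _ clamp_cts); cts.
have [_ k0 k1] := pk.
split=> [|s|s|t] /=.
- by apply: (cts_comp _ cg); cts.
- by rewrite subr0 mul1r mul0r addr0 -kE ?clamp01 // (path_clamp _ pk).
- by rewrite subrr mul1r mul0r add0r -lE ?clamp01 // (path_clamp _ pl).
split=> [|s s0|s s1].
- have cs (f : R -> R) : continuous f -> continuous (fun s => f (clamp s)).
    by move=> cf; apply: (cts_comp clamp_cts cf).
  by apply: (cts_comp _ cg); have := cs _ cphi; have := cs _ cpsi; move=> ? ?; cts.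
- by rewrite clamp_le0 // -e0 -mulrDl subrK mul1r -kE ?lexx ?ler01 // k0.
- by rewrite clamp_ge1 // -e1 -mulrDl subrK mul1r -kE ?lexx ?ler01 // k1.
Qed.

Definition pcls x y g (pg : is_path x y g) : Pi x y :=
  \pi_(Pi x y) (exist _ g (asboolT pg) : path x y).

Lemma pclsP x y (a : Pi x y) : exists g, exists pg : is_path x y g, a = pcls pg.
Proof.
exists (val (repr a)), (asboolW (valP (repr a))); rewrite -[LHS]reprK /pcls.
by congr (\pi_ _ _); apply: val_inj.
Qed.

Lemma pcls_eqP x y g h (pg : is_path x y g) (ph : is_path x y h) :
  pcls pg = pcls ph <-> path_homotopic x y g h.
Proof. by split=> [/eqmodP/asboolP//|H]; apply/eqmodP/asboolP. Qed.

Definition prepr x y (a : Pi x y) : R -> X := val (repr a).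

Lemma prepr_path x y (a : Pi x y) : is_path x y (prepr a).
Proof. exact/asboolP/(valP (repr a)). Qed.

Lemma preprK x y (a : Pi x y) : pcls (prepr_path a) = a.
Proof.
by rewrite -[RHS]reprK; congr (\pi_ _ _); apply: val_inj.
Qed.

Lemma prepr_homotopic x y g (pg : is_path x y g) :
  path_homotopic x y (prepr (pcls pg)) g.
Proof. by apply/(pcls_eqP (prepr_path _) pg); rewrite preprK. Qed.

Definition pcat g h (s : R) : X := if s - 2^-1 <= 0 then g (2 * s) else h (2 * s - 1).

Lemma pcat_path x y z g h : is_path x y g -> is_path y z h -> is_path x z (pcat g h).
Proof.
move=> [cg g0 g1] [ch h0 h1]; split=> [|s s0|s s1].
- apply: (@cts_glue R R X (fun s => s - 2^-1) (fun s => g (2 * s))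
    (fun s => h (2 * s - 1))); [by cts|
    by apply: (cts_comp _ cg); cts|by apply: (cts_comp _ ch); cts|].
  by move=> s /= s2; (have -> : 2 * s = 1 by lra); rewrite subrr g1 ?h0 ?lexx.
- by rewrite /pcat; (have -> : s - 2^-1 <= 0 by lra); rewrite g0 //; lra.
- by rewrite /pcat; (have -> : (s - 2^-1 <= 0) = false by lra); rewrite h1 //; lra.
Qed.

Lemma pcat_homotopic x y z g g' h h' :
  path_homotopic x y g g' -> path_homotopic y z h h' ->
  path_homotopic x z (pcat g h) (pcat g' h').
Proof.
move=> [H [cH H0 H1 Hp]] [K [cK K0 K1 Kp]].
exists (fun p => pcat (fun s => H (p.1, s)) (fun s => K (p.1, s)) p.2).
split=> [|s|s|t] /=.
- apply: (@cts_glue _ _ _ (fun p : R * R => p.2 - 2^-1)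
    (fun p => H (p.1, 2 * p.2)) (fun p => K (p.1, 2 * p.2 - 1)));
    [by cts|by apply: (cts_comp _ cH); cts|by apply: (cts_comp _ cK); cts|].
  move=> [t s] /= s2.
  have [_ _ /= e] := Hp t; have [_ /= e' _] := Kp t.
  by (have -> : 2 * s = 1 by lra); rewrite subrr e ?e' ?lexx.
- by rewrite /pcat H0 K0.
- by rewrite /pcat H1 K1.
exact: pcat_path (Hp t) (Kp t).
Qed.

Definition pinv g (s : R) : X := g (1 - s).

Lemma pinv_path x y g : is_path x y g -> is_path y x (pinv g).
Proof.
move=> [cg g0 g1]; split=> [|s s0|s s1].
- by apply: (cts_comp _ cg); cts.
- by rewrite /pinv g1 //; lra.
- by rewrite /pinv g0 //; lra.
Qed.

Lemma pinv_homotopic x y g g' :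
  path_homotopic x y g g' -> path_homotopic y x (pinv g) (pinv g').
Proof.
move=> [H [cH H0 H1 Hp]]; exists (fun p => H (p.1, 1 - p.2)); split=> [|s|s|t] /=.
- by apply: (cts_comp _ cH); cts.
- by rewrite H0.
- by rewrite H1.
exact: pinv_path (Hp t).
Qed.

Lemma cst_path x : is_path x x (fun _ => x).
Proof. by split=> //; cts. Qed.

Definition Pone x : Pi x x := pcls (cst_path x).
Definition Pcat x y z (a : Pi x y) (b : Pi y z) : Pi x z :=
  pcls (pcat_path (prepr_path a) (prepr_path b)).
Definition Pinv x y (a : Pi x y) : Pi y x := pcls (pinv_path (prepr_path a)).

Lemma Pcat_cls x y z g h (pg : is_path x y g) (ph : is_path y z h) :
  Pcat (pcls pg) (pcls ph) = pcls (pcat_path pg ph).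
Proof. by apply/pcls_eqP/pcat_homotopic; exact: prepr_homotopic. Qed.

Lemma Pinv_cls x y g (pg : is_path x y g) :
  Pinv (pcls pg) = pcls (pinv_path pg).
Proof. by apply/pcls_eqP/pinv_homotopic; exact: prepr_homotopic. Qed.

Lemma PcatA x y z w (a : Pi x y) (b : Pi y z) (c : Pi z w) :
  Pcat a (Pcat b c) = Pcat (Pcat a b) c.
Proof.
have [g [pg ->]] := pclsP a; have [h [ph ->]] := pclsP b.
have [k [pk ->]] := pclsP c; rewrite !Pcat_cls; apply/pcls_eqP.
pose phi (s : R) : R := if s - 2^-1 <= 0 then s / 2
  else if s - 3 / 4 <= 0 then s - 4^-1 else 2 * s - 1.
have [cg _ _] := pcat_path (pcat_path pg ph) pk.
apply: (@path_homotopic_param _ _ _ _ _ phi (fun s => s) cg) => //.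
- apply: (@cts_glue R R R (fun s => s - 2^-1) (fun s => s / 2)
    (fun s => if s - 3 / 4 <= 0 then s - 4^-1 else 2 * s - 1)); [by cts..| |].
    by apply: (@cts_glue R R R (fun s => s - 3 / 4) (fun s => s - 4^-1)
      (fun s => 2 * s - 1));
    [by cts..|move=> s /=; lra].
  by move=> s /= s2; (have -> : s - 3 / 4 <= 0 by lra); lra.
- by cts.
- exact: pcat_path pg (pcat_path ph pk).
- exact: pcat_path (pcat_path pg ph) pk.
- by rewrite /phi; (have -> : 0 - 2^-1 <= 0 :> R by lra); lra.
- rewrite /phi; have -> : (1 - 2^-1 <= 0 :> R) = false by lra.
  by (have -> : (1 - 3 / 4 <= 0 :> R) = false by lra); lra.
move=> s s01; rewrite /phi /pcat; have [s2|s2] := boolP (s - 2^-1 <= 0).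
  have -> : s / 2 - 2^-1 <= 0 by lra.
  by (have -> : 2 * (s / 2) - 2^-1 <= 0 by lra); congr g; lra.
have [s4|s4] := boolP (s - 3 / 4 <= 0).
  have -> : s - 4^-1 - 2^-1 <= 0 by lra.
  have -> : (2 * (s - 4^-1) - 2^-1 <= 0) = false by lra.
  by (have -> : 2 * s - 1 - 2^-1 <= 0 by lra); congr h; lra.
have -> : (2 * s - 1 - 2^-1 <= 0) = false by lra.
by [].
Qed.

Lemma P1cat x y (a : Pi x y) : Pcat (Pone x) a = a.
Proof.
have [g [pg ->]] := pclsP a; rewrite Pcat_cls; apply/pcls_eqP.
pose phi (s : R) : R := if s - 2^-1 <= 0 then 0 else 2 * s - 1.
have [cg g0 _] := pg.
apply: (@path_homotopic_param _ _ _ _ _ phi (fun s => s) cg) => //.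
- by apply: (@cts_glue R R R (fun s => s - 2^-1) (fun _ => 0) (fun s => 2 * s - 1));
    [by cts..|move=> s /=; lra].
- by cts.
- exact: pcat_path (cst_path x) pg.
- by rewrite /phi; have -> : 0 - 2^-1 <= 0 :> R by lra.
- by rewrite /phi; (have -> : (1 - 2^-1 <= 0 :> R) = false by lra); lra.
by move=> s s01; rewrite /phi /pcat; case: ifP => // _; rewrite g0.
Qed.

Lemma Pcat1 x y (a : Pi x y) : Pcat a (Pone y) = a.
Proof.
have [g [pg ->]] := pclsP a; rewrite Pcat_cls; apply/pcls_eqP.
pose phi (s : R) : R := if s - 2^-1 <= 0 then 2 * s else 1.
have [cg _ g1] := pg.
apply: (@path_homotopic_param _ _ _ _ _ phi (fun s => s) cg) => //.
- by apply: (@cts_glue R R R (fun s => s - 2^-1) (fun s => 2 * s) (fun _ => 1));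
    [by cts..|move=> s /=; lra].
- by cts.
- exact: pcat_path pg (cst_path y).
- by rewrite /phi; (have -> : 0 - 2^-1 <= 0 :> R by lra); lra.
- by rewrite /phi; have -> : (1 - 2^-1 <= 0 :> R) = false by lra.
by move=> s s01; rewrite /phi /pcat; case: ifP => // _; rewrite g1.
Qed.

Lemma PcatV x y (a : Pi x y) : Pcat a (Pinv a) = Pone x.
Proof.
have [g [pg ->]] := pclsP a; rewrite Pinv_cls Pcat_cls; apply/pcls_eqP.
pose phi (s : R) : R := if s - 2^-1 <= 0 then 2 * s else 2 - 2 * s.
have [cg g0 _] := pg.
apply: (@path_homotopic_param _ _ _ _ _ phi (fun s => 0) cg) => //.
- by apply: (@cts_glue R R R (fun s => s - 2^-1) (fun s => 2 * s) (fun s => 2 - 2 * s));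
    [by cts..|move=> s /=; lra].
- by cts.
- exact: pcat_path pg (pinv_path pg).
- exact: cst_path.
- by rewrite /phi; (have -> : 0 - 2^-1 <= 0 :> R by lra); lra.
- by rewrite /phi; (have -> : (1 - 2^-1 <= 0 :> R) = false by lra); lra.
- move=> s s01; rewrite /phi /pcat /pinv; case: ifP => // _; congr g; lra.
by move=> s _; rewrite g0.
Qed.

Lemma PinvK x y (a : Pi x y) : Pinv (Pinv a) = a.
Proof.
have [g [pg ->]] := pclsP a; rewrite !Pinv_cls; apply/pcls_eqP.
suff -> : pinv (pinv g) = g by exact: path_homotopic_refl.
by apply/funext => s; rewrite /pinv; congr g; lra.
Qed.

Lemma PVcat x y (a : Pi x y) : Pcat (Pinv a) a = Pone y.
Proof. by rewrite -{2}(PinvK a) PcatV. Qed.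

Definition seg (g : R -> X) (t u : R) (s : R) : X := g (t + (u - t) * clamp s).

Lemma seg_path g t u : continuous g -> is_path (g t) (g u) (seg g t u).
Proof.
move=> cg; split=> [|s s0|s s1].
- apply: (cts_comp _ cg); have := clamp_cts => ?; cts.
- by rewrite /seg clamp_le0 // mulr0 addr0.
- by rewrite /seg clamp_ge1 // mulr1 addrC subrK.
Qed.

Lemma seg_cat g t u v (cg : continuous g) :
  Pcat (pcls (seg_path t u cg)) (pcls (seg_path u v cg)) = pcls (seg_path t v cg).
Proof.
rewrite Pcat_cls; apply/pcls_eqP.
pose phi (s : R) := if s - 2^-1 <= 0 then t + (u - t) * (2 * s)
  else u + (v - u) * (2 * s - 1).
apply: (@path_homotopic_param _ _ g _ _ phi (fun s => t + (v - t) * s)) => //.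
- by apply: (@cts_glue R R R (fun s => s - 2^-1) (fun s => t + (u - t) * (2 * s))
    (fun s => u + (v - u) * (2 * s - 1))); [by cts..|move=> s /= s2; nra].
- by cts.
- exact: pcat_path (seg_path t u cg) (seg_path u v cg).
- exact: seg_path.
- by rewrite /phi; (have -> : 0 - 2^-1 <= 0 :> R by lra); rewrite !mulr0.
- rewrite /phi; (have -> : (1 - 2^-1 <= 0 :> R) = false by lra); lra.
- move=> s s01; rewrite /pcat /phi /seg; case: ifP => s2.
    by rewrite clamp_id //; lra.
  by rewrite clamp_id //; lra.
- by move=> s s01; rewrite /seg clamp_id.
Qed.

End classes.

(** * Loops on the cube and loops on the line *)

Lemma cts_mx (T U : topologicalType) m n (f : T -> 'M[U]_(m, n)) :
  (forall i j, continuous (fun x => f x i j)) -> continuous f.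
Proof.
move=> cf x W [P nP PW].
have : \forall y \near x, forall i j, P i j (f y i j).
  by apply: filter_forall => i; apply: filter_forall => j; exact: (cf i j x _ (nP i j)).
by apply: filterS => y Py; apply: PW.
Qed.

Lemma cts_coord (T U : topologicalType) m n (f : T -> 'M[U]_(m, n)) i j :
  continuous f -> continuous (fun x => f x i j).
Proof.
move=> cf x W nW; apply: (cf x [set M : 'M[U]_(m, n) | W (M i j)]).
exists (fun k l => if (k == i) && (l == j) then W else setT).
  by move=> k l; case: ifP => [/andP[/eqP-> /eqP->]//|_]; exact: filterT.
by move=> M /(_ i j); rewrite !eqxx.
Qed.

Lemma cts_val (U : topologicalType) (A : set U) : continuous (\val : A -> U).
Proof. exact: initial_continuous. Qed.

Section map_classes.
Context {R : realType} {X Y : topologicalType}.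
Variable phi : X -> Y.
Hypothesis cphi : continuous phi.

Lemma is_path_map x y (g : R -> X) :
  is_path x y g -> is_path (phi x) (phi y) (phi \o g).
Proof.
move=> [cg g0 g1]; split=> [|s s0|s s1] /=.
- exact: (cts_comp cg cphi).
- by rewrite g0.
- by rewrite g1.
Qed.

Lemma path_homotopic_map x y (g h : R -> X) : path_homotopic x y g h ->
  path_homotopic (phi x) (phi y) (phi \o g) (phi \o h).
Proof.
move=> [H [cH H0 H1 Hp]]; exists (phi \o H); split=> [|s|s|t] /=.
- exact: (cts_comp cH cphi).
- by rewrite H0.
- by rewrite H1.
- exact: is_path_map (Hp t).
Qed.

Definition Pmap x y (a : @Pi R X x y) : @Pi R Y (phi x) (phi y) :=
  pcls (is_path_map (prepr_path a)).

Lemma Pmap_cls x y (g : R -> X) (pg : is_path x y g) :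
  Pmap (pcls pg) = pcls (is_path_map pg).
Proof. by apply/pcls_eqP/path_homotopic_map; exact: prepr_homotopic. Qed.

Lemma Pmap1 x : Pmap (Pone x) = Pone (phi x).
Proof. by rewrite /Pone Pmap_cls; apply/pcls_eqP; exact/path_homotopic_refl/cst_path. Qed.

End map_classes.

Section loops.
Context {R : realType} {X : topologicalType}.

Definition mkcts (T U : topologicalType) (f : T -> U) (cf : continuous f) :
  continuousType T U := HB.pack f (isContinuous.Build T U f cf).

Definition cube_point (s : R) : 'rV[R]_1 := const_mx (clamp s).

Lemma cube_pointP s : cube_point s \in @cube R 1.
Proof. by rewrite inE => i; rewrite mxE clamp01. Qed.

(** The unit interval as the one-dimensional cube. *)
Definition pt (s : R) : @cube R 1 := exist _ (cube_point s) (cube_pointP s).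

Lemma pt_cts : continuous pt.
Proof.
apply: continuous_comp_initial; apply: cts_mx => i j.
rewrite (_ : (fun x => _) = clamp); first exact: clamp_cts.
by apply/funext => s; rewrite /= mxE.
Qed.

Definition unpt (c : @cube R 1) : R := val c 0 0.

Lemma unpt_cts : continuous unpt.
Proof. by apply: cts_coord; exact: cts_val. Qed.

Lemma unpt01 c : 0 <= unpt c <= 1.
Proof. by have := valP c; rewrite inE; exact. Qed.

Lemma unptK : cancel unpt pt.
Proof.
move=> c; apply: val_inj; apply/rowP => i; rewrite mxE clamp_id ?unpt01 //.
by rewrite [i]ord1.
Qed.

Lemma ptK s : unpt (pt s) = clamp s.
Proof. by rewrite /unpt mxE. Qed.

Lemma boundary_pt c : cube_boundary c <-> unpt c = 0 \/ unpt c = 1.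
Proof.
split=> [[i]|h]; first by rewrite [i]ord1.
by exists 0.
Qed.

Lemma loop_path (x : X) (l : loop R 1 x) : is_path x x (fun s => val l (pt s)).
Proof.
have lb := asboolP _ (valP l).
split=> [|s s0|s s1]; first exact: (cts_comp pt_cts (@cts_fun _ _ (val l))).
- by apply: lb; apply/boundary_pt; rewrite ptK clamp_le0 //; left.
- by apply: lb; apply/boundary_pt; rewrite ptK clamp_ge1 //; right.
Qed.

Lemma is_path_cts (x y : X) (g : R -> X) : is_path x y g -> continuous g.
Proof. by case. Qed.

Lemma path_loop_subproof (x : X) (g : R -> X) (pg : is_path x x g) :
  `[< forall c, cube_boundary c ->
      mkcts (cts_comp unpt_cts (is_path_cts pg)) c = x >].
Proof.
apply/asboolP => c /boundary_pt /= [] e; rewrite /= e; case: pg => _ g0 g1.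
  by rewrite g0.
by rewrite g1.
Qed.

Definition path_loop (x : X) (g : R -> X) (pg : is_path x x g) : loop R 1 x :=
  exist _ (mkcts (cts_comp unpt_cts (is_path_cts pg))) (path_loop_subproof pg).

Lemma loop_homotopicP (x : X) (l m : loop R 1 x) :
  @homotopic_rel R _ _ (@cube_boundary R 1) (val l) (val m) <->
  path_homotopic x x (fun s => val l (pt s)) (fun s => val m (pt s)).
Proof.
split=> [[H [cH H0 H1 HB]]|[K [cK K0 K1 Kp]]].
  have lb := asboolP _ (valP l).
  exists (fun p => H (clamp p.1, pt p.2)); split=> [|s|s|t] /=.
  - apply/continuous_subspace_setT.
    apply: (@Defs.within_continuous_comp _ _ _ setT _ (fun p => (clamp p.1, pt p.2)) H _ _ cH).
      apply: cts_pair; [apply: (cts_comp _ clamp_cts)|apply: (cts_comp _ pt_cts)]; cts.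
    by move=> p _; split=> //=; rewrite in_itv /= clamp01.
  - by rewrite clamp_le0 // H0.
  - by rewrite clamp_ge1 // H1.
  split=> [|s s0|s s1].
  - have : continuous (H \o (fun s => (clamp t, pt s))).
      apply/continuous_subspace_setT.
      apply: (@Defs.within_continuous_comp _ _ _ setT _ (fun s => (clamp t, pt s)) H _ _ cH).
        by apply: cts_pair; [cts|exact: pt_cts].
      by move=> p _; split=> //=; rewrite in_itv /= clamp01.
    by [].
  - rewrite HB ?clamp01 //; first by apply: lb; apply/boundary_pt; rewrite ptK clamp_le0 //; left.
    by apply/boundary_pt; rewrite ptK clamp_le0 //; left.
  - rewrite HB ?clamp01 //; first by apply: lb; apply/boundary_pt; rewrite ptK clamp_ge1 //; right.
    by apply/boundary_pt; rewrite ptK clamp_ge1 //; right.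
have lb := asboolP _ (valP l).
exists (fun p => K (p.1, unpt p.2)); split=> [|c|c|s c s01 cb].
- apply: continuous_subspaceT; apply: (cts_comp _ cK).
  by apply: cts_pair; [cts|apply: (cts_comp _ unpt_cts); cts].
- by rewrite K0 /= unptK.
- by rewrite K1 /= unptK.
have [_ k0 k1] := Kp s; rewrite lb //.
by have /boundary_pt[] := cb => /= ->; [exact: k0|exact: k1].
Qed.

End loops.

(** * Fundamental groups with two elements and weak equivalences *)

Section two_element_groups.
Context {R : realType}.
Implicit Types X Y : topologicalType.

Lemma path_relatedE X (x y : X) :
  path_related R x y <-> exists a : @Pi R X x y, True.
Proof.
split=> [/asboolP[g [cg g0 g1]]|[a _]].
  suff pg : is_path x y (g \o clamp) by exists (pcls pg).
  split=> [|s s0|s s1] /=; [|by rewrite clamp_le0|by rewrite clamp_ge1].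
  apply/continuous_subspace_setT.
  apply: (@Defs.within_continuous_comp _ _ _ setT _ clamp g _ _ cg).
    exact: clamp_cts.
  by move=> s _; rewrite /= in_itv /= clamp01.
have [g [[cg g0 g1] _]] := pclsP a.
apply/asboolP; exists g; split; first exact: continuous_subspaceT.
  exact: g0.
exact: g1.
Qed.

Lemma path_loopE X (x : X) (g : R -> X) (pg : is_path x x g) :
  (fun s => val (path_loop pg) (pt s)) = g.
Proof. by apply/funext => s; rewrite /= ptK (path_clamp _ pg). Qed.

Section weak_equivalence.
Context {X Y : topologicalType} (phi : continuousType X Y).
Hypothesis whe : weak_homotopy_equivalence R phi.

Let cphi : continuous phi := @cts_fun _ _ phi.

Lemma weak_Pmap_inj x : injective (fun a : @Pi R X x x => Pmap cphi a).
Proof.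
move=> a b; have [g [pg ->]] := pclsP a; have [h [ph ->]] := pclsP b.
rewrite !Pmap_cls => /pcls_eqP gh.
have [_ /(_ 1 x isT)/bij_inj inj] := whe.
have /inj/eqmodP/asboolP : homotopy_group_map phi (\pi_(homotopy_group R 1 x) (path_loop pg)) =
    homotopy_group_map phi (\pi_(homotopy_group R 1 x) (path_loop ph)).
  rewrite !homotopy_group_mapE; apply/eqmodP/asboolP/loop_homotopicP => /=.
  have e (k : R -> X) (pk : is_path x x k) :
      (fun s => phi (k (unpt (pt s)))) = phi \o k.
    by apply/funext => s; rewrite ptK /= (path_clamp _ pk).
  by rewrite (e g) // (e h).
by move=> /loop_homotopicP; rewrite !path_loopE => ?; apply/pcls_eqP.
Qed.

Lemma weak_Pmap_surj x (b : @Pi R Y (phi x) (phi x)) : exists a : @Pi R X x x, Pmap cphi a = b.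
Proof.
have [g [pg ->]] := pclsP b.
have [_ /(_ 1 x isT)[psi _ psiK]] := whe.
have := psiK (\pi_(homotopy_group R 1 (phi x)) (path_loop pg)).
rewrite -[psi _]reprK homotopy_group_mapE; set l := repr _.
move=> /eqmodP/asboolP/loop_homotopicP; rewrite path_loopE => lg.
exists (pcls (loop_path l)); rewrite Pmap_cls; apply/pcls_eqP.
exact: lg.
Qed.

Lemma weak_pi0_inj (x y : X) :
  (exists b : @Pi R Y (phi x) (phi y), True) -> exists a : @Pi R X x y, True.
Proof.
move=> /path_relatedE xy; apply/path_relatedE.
have [/bij_inj inj _] := whe; apply/eqmodP/inj.
by rewrite !pi0_mapE; apply/eqmodP.
Qed.

Lemma weak_pi0_surj (y : Y) : exists x, exists b : @Pi R Y (phi x) y, True.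
Proof.
have [[psi _ psiK] _] := whe.
exists (repr (psi (\pi_(pi0 R Y) y))); apply/path_relatedE/eqmodP.
by rewrite -pi0_mapE reprK psiK.
Qed.

End weak_equivalence.

(** Only the number of classes is recorded, so that the property can be carried
    along bijections that are not known to respect composition. *)
Definition order2 X (x : X) :=
  exists2 a : @Pi R X x x, a <> Pone x & forall b, b = Pone x \/ b = a.

Definition projective_like X :=
  [/\ exists x : X, True, forall x y : X, exists a : @Pi R X x y, True &
      forall x : X, order2 x].

(** Conjugation with [q] is a bijection between the loops at [y] and at [x]. *)
Lemma order2_transport X (x y : X) (q : @Pi R X x y) : order2 y -> order2 x.
Proof.
move=> [a a1 aP]; exists (Pcat q (Pcat a (Pinv q))) => [e|b].
  apply: a1; have := congr1 (fun u => Pcat (Pinv q) (Pcat u q)) e.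
  rewrite P1cat PVcat -!PcatA PVcat Pcat1 PcatA PVcat P1cat; exact.
have bE : b = Pcat q (Pcat (Pcat (Pinv q) (Pcat b q)) (Pinv q)).
  by rewrite -!PcatA PcatV Pcat1 PcatA PcatV P1cat.
case: (aP (Pcat (Pinv q) (Pcat b q))) => e; rewrite e in bE.
  by left; rewrite bE P1cat PcatV.
by right.
Qed.

(** In the direction from [X] to [Y] a point of [Y] need not be in the image of
    [phi]; it is connected to a point of the image, and the fundamental group is
    transported along a path between them. *)
Lemma projective_like_weak X Y (phi : continuousType X Y) :
  weak_homotopy_equivalence R phi -> projective_like X <-> projective_like Y.
Proof.
move=> whe; split=> -[[x _] conn two].
  split; first by exists (phi x).
    move=> y y'; have [u [b _]] := weak_pi0_surj whe y.
    have [u' [b' _]] := weak_pi0_surj whe y'.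
    have [a _] := conn u u'.
    by exists (Pcat (Pinv b) (Pcat (Pmap (@cts_fun _ _ phi) a) b')).
  move=> y; have [u [b _]] := weak_pi0_surj whe y.
  apply: (order2_transport (Pinv b)).
  have [a a1 aP] := two u.
  exists (Pmap (@cts_fun _ _ phi) a) => [e|c].
    by apply: a1; apply: (weak_Pmap_inj whe); rewrite e Pmap1.
  have [d <-] := weak_Pmap_surj whe c.
  by case: (aP d) => ->; [left; rewrite Pmap1 | right].
have [u _] := weak_pi0_surj whe x.
split; first by exists u.
  by move=> y y'; apply: (weak_pi0_inj whe).
move=> y; have [a a1 aP] := two (phi y).
have [b ba] := weak_Pmap_surj whe a.
exists b => [e|c]; first by apply: a1; rewrite -ba e Pmap1.
case: (aP (Pmap (@cts_fun _ _ phi) c)) => e; [left|right];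
  by apply: (weak_Pmap_inj whe); rewrite e ?Pmap1.
Qed.

Lemma projective_like_equiv X Y :
  weak_homotopy_equivalent R X Y -> projective_like X <-> projective_like Y.
Proof.
elim=> [U V [phi]|U|U V _ UV|U V W _ UV _ VW].
- exact: projective_like_weak.
- by [].
- by symmetry.
- by rewrite UV.
Qed.

End two_element_groups.

(** * Monodromy on the unit square *)

(** The compactness argument behind the Lebesgue number, for a property [good] of
    subsets that is inherited by smaller subsets. *)
Lemma lebesgue_number (R : realType) (M : pseudoMetricType R) (K : set M)
    (good : set M -> Prop) : compact K ->
    (forall A B, A `<=` B -> good B -> good A) ->
    (forall x, K x -> exists2 e : R, 0 < e & good (ball x e)) ->
  exists2 e : R, 0 < e & forall x, K x -> good (ball x e).
Proof.
move=> /compact_near_coveringP cK mono loc.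
have : \forall e \near 0^'+, K `<=` (fun x => good (ball x e)).
  apply: (cK _ _ (fun (e : R) x => good (ball x e))) => x /loc[e e0 ge].
  near=> y d; have xy : ball x (e / 2) y by near: y; apply: near_ball; lra.
  have de : d <= e / 2 by near: d; apply: nbhs_right_ltW; lra.
  apply: mono ge => z yz; rewrite [e]splitr.
  exact: ball_triangle xy (le_ball de yz).
move=> h; have {h} : \forall e \near 0^'+, 0 < e /\ K `<=` (fun x => good (ball x e)).
  by near=> e; split; near: e => //; exact: nbhs_right_gt.
by move=> /filter_ex[e [e0 Ke]]; exists e.
Unshelve. all: by end_near.
Qed.

Section locally_constant.
Context {R : realType}.

Lemma locally_constant01 (T : Type) (f : R -> T) :
    (forall t : R, 0 <= t <= 1 -> \forall s \near t, 0 <= s <= 1 -> f s = f t) ->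
  forall t : R, 0 <= t <= 1 -> f t = f 0.
Proof.
move=> loc.
pose A : set R := [set t | f (clamp t) = f 0].
have oA (B : set R) : (forall t, B t <-> B (clamp t)) ->
    (forall s t, 0 <= s <= 1 -> 0 <= t <= 1 -> f s = f t -> B s -> B t) -> open B.
  move=> Bc Bf; rewrite openE => t /Bc Bt; rewrite /interior.
  have nt : \forall s \near t, 0 <= clamp s <= 1 -> f (clamp s) = f (clamp t).
    exact: (clamp_cts (loc _ (clamp01 t))).
  apply: filterS nt => s /(_ (clamp01 s)) e; apply/Bc.
  exact: (Bf _ _ (clamp01 t) (clamp01 s) (esym e) Bt).
have clampK t : clamp (clamp t) = clamp t by rewrite clamp_id ?clamp01.
have AT : A = setT.
  have cT : connected [set: R] by apply/connected_intervalP.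
  apply: cT.
  - by exists 0; rewrite /A /= clamp_le0.
  - exists A; rewrite ?setTI //; apply: oA => [t|s t s01 t01 st].
      by rewrite /A /= clampK.
    by rewrite /A /= !clamp_id // st.
  - exists A; rewrite ?setTI // -[A]setCK; apply: open_closedC.
    apply: oA => [t|s t s01 t01 st]; first by rewrite /A /= clampK.
    by rewrite /A /= !clamp_id // st.
move=> t t01; have : A t by rewrite AT.
by rewrite /A /= clamp_id.
Qed.

End locally_constant.

Lemma subr_swap (G : zmodType) (x y z w : G) : x - y = z - w -> x - z = y - w.
Proof. by move=> /(canRL (subrK _))->; rewrite addrC !addrA addNr add0r addrC. Qed.

Section monodromy.
Context {R : realType} {G : zmodType}.
Variable D : R * R -> R * R -> G.
Hypothesis D_local : forall z0, \forall z \near z0, \forall w \near z,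
  D z0 w - D z0 z = D z w.
Implicit Types K : set (R * R).

(** [D z w] prescribes the variation from [z] to a nearby point [w]; the
    hypothesis on [D] is the cocycle condition near the diagonal. Primitives are
    the lifts of a map to a covering space with group [G], written with respect
    to a discontinuous trivialization. *)
Definition primitive K (a : R * R -> G) :=
  forall z, K z -> \forall w \near z, K w -> a w - a z = D z w.

Definition has_primitive K := exists a, primitive K a.

Definition convex_set K := forall p q (t : R), K p -> K q -> 0 <= t <= 1 ->
  K ((1 - t) * p.1 + t * q.1, (1 - t) * p.2 + t * q.2).

Lemma convex_setI K L : convex_set K -> convex_set L -> convex_set (K `&` L).
Proof.
by move=> cK cL p q t [Kp Lp] [Kq Lq] t01; split; [exact: cK|exact: cL].
Qed.

Lemma convex_slab1 (a b : R) : convex_set [set p | a <= p.1 <= b].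
Proof. by move=> p q t /= h h' t01; nra. Qed.

Lemma convex_slab2 (a b : R) : convex_set [set p | a <= p.2 <= b].
Proof. by move=> p q t /= h h' t01; nra. Qed.

Lemma has_primitiveS K L : K `<=` L -> has_primitive L -> has_primitive K.
Proof.
move=> KL [a aL]; exists a => z /KL /aL; apply: filterS => w h /KL; exact: h.
Qed.

Lemma primitive_unique K a b p q : convex_set K ->
  primitive K a -> primitive K b -> K p -> K q -> a p - b p = a q - b q.
Proof.
move=> cK aK bK Kp Kq.
pose l (t : R) := ((1 - t) * p.1 + t * q.1, (1 - t) * p.2 + t * q.2).
have lc : continuous l by rewrite /l; cts.
have l0 : l 0 = p by rewrite /l subr0 !mul1r !mul0r !addr0 -surjective_pairing.
have l1 : l 1 = q by rewrite /l subrr !mul1r !mul0r !add0r -surjective_pairing.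
rewrite -l0 -l1; apply/esym.
apply: (@locally_constant01 _ _ (fun t => a (l t) - b (l t))); last by rewrite ler01 lexx.
move=> t t01; have Klt : K (l t) by exact: cK.
have na : \forall s \near t, K (l s) -> a (l s) - a (l t) = D (l t) (l s).
  by exact: (lc t _ (aK _ Klt)).
have nb : \forall s \near t, K (l s) -> b (l s) - b (l t) = D (l t) (l s).
  by exact: (lc t _ (bK _ Klt)).
apply: filterS2 na nb => s ha hb s01; have Kls : K (l s) by exact: cK.
by apply: subr_swap; rewrite ha // hb.
Qed.

(** On the common edge of the two halves the two primitives differ by a constant,
    because the edge is convex. *)
Lemma has_primitive_glue K (c : R) (u : R * R -> R) : continuous u ->
    convex_set K -> convex_set (K `&` [set p | u p = c]) ->
    has_primitive (K `&` [set p | u p <= c]) ->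
    has_primitive (K `&` [set p | c <= u p]) -> has_primitive K.
Proof.
move=> cu cK cKc [a aK] [b bK].
have aKc : primitive (K `&` [set p | u p = c]) a.
  move=> z [Kz /= uz]; have := aK z; rewrite /= uz lexx => /(_ (conj Kz isT)).
  by apply: filterS => w h [Kw /= uw]; apply: h; split=> //=; rewrite uw.
have bKc : primitive (K `&` [set p | u p = c]) b.
  move=> z [Kz /= uz]; have := bK z; rewrite /= uz lexx => /(_ (conj Kz isT)).
  by apply: filterS => w h [Kw /= uw]; apply: h; split=> //=; rewrite uw.
have [k kP] : exists k, forall p, K p -> u p = c -> a p = b p + k.
  have [[p [Kp up]]|no] := pselect (exists p, (K `&` [set p | u p = c]) p); last first.
    by exists 0 => p Kp up; exfalso; apply: no; exists p.
  exists (a p - b p) => q Kq uq.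
  rewrite (primitive_unique cKc aKc bKc (conj Kp up) (conj Kq uq)).
  by rewrite addrCA subrr addr0.
exists (fun p => if u p <= c then a p else b p + k) => z Kz.
have [uz|uz|uz] := ltgtP (u z) c.
- have n1 : \forall w \near z, u w < c by exact: (cu z _ (lt_nbhsl uz)).
  have n2 := aK z (conj Kz (ltW uz)).
  by apply: filterS2 n1 n2 => w /ltW uw h Kw; rewrite uw; apply: h.
- have n1 : \forall w \near z, c < u w by exact: (cu z _ (lt_nbhsr uz)).
  have n2 := bK z (conj Kz (ltW uz)).
  apply: filterS2 n1 n2 => w uw h Kw; rewrite leNgt uw /= opprD addrACA subrr addr0.
  by apply: h; split=> //=; exact: ltW.
have n1 : \forall w \near z, (K `&` [set p | u p <= c]) w -> a w - a z = D z w.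
  by apply: aK; split=> //=; rewrite uz.
have n2 : \forall w \near z, (K `&` [set p | c <= u p]) w -> b w - b z = D z w.
  by apply: bK; split=> //=; rewrite uz.
apply: filterS2 n1 n2 => w ha hb Kw; case: (leP (u w) c) => uw; first exact: ha.
by rewrite kP // opprD addrACA subrr addr0; apply: hb; split=> //=; exact: ltW.
Qed.

Let square (a c d : R) : set (R * R) :=
  [set p | a <= p.1 <= a + d] `&` [set p | c <= p.2 <= c + d].

Let unit_square := square 0 0 1.

Let square_convex a c d : convex_set (square a c d).
Proof.
by apply: convex_setI; [exact: convex_slab1 | exact: convex_slab2].
Qed.

(** Near a point [z] the function [D z] is a primitive, so by compactness all
    sufficiently small squares have one. Cutting a square into four quarters
    doubles the size of the squares that have a primitive. *)
Lemma monodromy : exists a : R * R -> G, forall z : R * R,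
  0 <= z.1 <= 1 -> 0 <= z.2 <= 1 ->
  \forall w \near z, 0 <= w.1 <= 1 -> 0 <= w.2 <= 1 -> a w - a z = D z w.
Proof.
suff [a aK] : has_primitive unit_square.
  exists a => z z1 z2; have := aK z; rewrite /unit_square /square /= add0r.
  by move=> /(_ (conj z1 z2)); apply: filterS => w h w1 w2; apply: h.
have [e e0 ge] : exists2 e : R, 0 < e & forall z, unit_square z -> has_primitive (ball z e).
  apply: lebesgue_number => [|A B AB|z _].
  - have -> : unit_square = `[0, 1] `*` `[0, 1].
      by rewrite /unit_square /square; apply/seteqP; split=> -[x y] /=;
        rewrite !in_itv /= !add0r.
    by apply: compact_setX; exact: segment_compact.
  - exact: has_primitiveS.
  - have /nbhs_ballP[e /= e0 eD] := D_local z.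
    by exists e => //; exists (D z) => w /eD; apply: filterS => w' h _.
have small k a c : has_primitive (unit_square `&` square a c (2 ^+ k * (e / 2))).
  elim: k a c => [|k IH] a c.
    have [[z [Uz Sz]]|no] :=
        pselect (exists z, (unit_square `&` square a c (2 ^+ 0 * (e / 2))) z); last first.
      by exists (fun _ => 0) => z Uz; exfalso; apply: no; exists z.
    apply: has_primitiveS (ge z Uz) => w [_ []] /=; rewrite expr0 mul1r => w1 w2.
    case: Sz => /=; rewrite expr0 mul1r => z1 z2.
    by split; rewrite /ball /= ltr_distlC; lra.
  have e_k : 2 ^+ k.+1 * (e / 2) = 2 ^+ k * (e / 2) + 2 ^+ k * (e / 2).
    by rewrite exprS; lra.
  move: e_k; set d := 2 ^+ k * (e / 2) in IH *.
  move: (2 ^+ k.+1 * (e / 2)) => s sE.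
  have d0 : 0 <= d by rewrite mulr_ge0 ?exprn_ge0 //; lra.
  have half b : has_primitive (unit_square `&` ([set p | a <= p.1 <= a + s] `&`
      [set p | b <= p.2 <= b + d])).
    apply: (@has_primitive_glue _ (a + d) fst).
    - by move=> -[x y]; exact: cvg_fst.
    - by apply: (convex_setI (@square_convex _ _ _)); apply: convex_setI;
        [exact: convex_slab1|exact: convex_slab2].
    - rewrite (_ : [set p | p.1 = a + d] = [set p | a + d <= p.1 <= a + d]).
        apply: convex_setI; last exact: convex_slab1.
        by apply: (convex_setI (@square_convex _ _ _)); apply: convex_setI;
          [exact: convex_slab1|exact: convex_slab2].
      by apply/seteqP; split=> p /=; lra.
    - apply: has_primitiveS (IH a b) => p [[Up [/= p1 p2]] /= p3].
      by split=> //; split=> //=; lra.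
    - apply: has_primitiveS (IH (a + d) b) => p [[Up [/= p1 p2]] /= p3].
      by split=> //; split=> //=; lra.
  apply: (@has_primitive_glue _ (c + d) snd).
  - by move=> -[x y]; exact: cvg_snd.
  - by apply: convex_setI; exact: square_convex.
  - rewrite (_ : [set p | p.2 = c + d] = [set p | c + d <= p.2 <= c + d]).
      apply: convex_setI; last exact: convex_slab2.
      by apply: convex_setI; exact: square_convex.
    by apply/seteqP; split=> p /=; lra.
  - apply: has_primitiveS (half c) => p [[Up [/= p1 p2]] /= p3].
    by split=> //; split=> //=; lra.
  - apply: has_primitiveS (half (c + d)) => p [[Up [/= p1 p2]] /= p3].
    by split=> //; split=> //=; lra.
have [k ke] : exists k, 1 <= 2 ^+ k * (e / 2).
  pose k := (Num.bound (2 / e)).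
  exists k; have h : 2 / e < 2 ^+ k.
    apply: lt_le_trans (_ : k%:R <= _); first by apply: archi_boundP; rewrite divr_ge0 // ltW.
    by rewrite -natrX ler_nat ltnW // ltn_expl.
  by move: h; rewrite ltr_pdivrMr //; lra.
apply: has_primitiveS (small k 0 0) => p Up; split=> //; move: Up => [/= p1 p2].
by split=> /=; lra.
Qed.

End monodromy.

(** * Finite spaces whose fundamental group has two elements *)

Section finite_spaces.
Context {R : realType} {X : topologicalType}.
Hypothesis finX : finite_set [set: X].
Implicit Types x y z : X.
Local Notation Pi := (@Pi R X).

(** The specialization preorder: [x] lies in the smallest open set of [y]. *)
Definition spec_le x y := `[< forall U : set X, open U -> U y -> U x >].
Local Notation le := spec_le.

Lemma spec_le_refl : reflexive le.
Proof. by move=> x; apply/asboolP. Qed.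

Lemma spec_le_trans : transitive le.
Proof. by move=> y x z /asboolP xy /asboolP yz; apply/asboolP => U oU /(yz _ oU) /(xy _ oU). Qed.

Lemma spec_le_nbhs x y (W : set X) : le x y -> nbhs y W -> W x.
Proof. by move=> /asboolP xy; rewrite nbhsE => -[U [oU Uy] UW]; apply: UW; exact: xy. Qed.

(** Finitely many open sets separate [y] from the points that are not below it. *)
Lemma near_spec_le y : \forall x \near y, le x y.
Proof.
pose D := fset_set [set x | ~~ le x y].
have : nbhs y (\bigcap_(x in [set` D]) ~` [set x]).
  apply: filter_bigI => x; rewrite in_fset_set; last exact: sub_finite_set finX.
  rewrite inE /= => /asboolPn/existsNP[U /not_implyP[oU /not_implyP[Uy nUx]]].
  by rewrite nbhsE; exists U => // u Uu /= ux; apply: nUx; rewrite -ux.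
apply: filterS => x h; apply: contrapT => /negP nxy.
apply: (h x) => //=.
by rewrite in_fset_set ?inE //; exact: sub_finite_set finX.
Qed.

(** The jump is continuous because every neighbourhood of [y] contains [x], and
    the larger point [y] is taken on a closed set of parameters. *)
Lemma edge_is_path x y : le x y -> is_path x y (fun s : R => if 1 <= s then y else x).
Proof.
move=> xy; split=> [s W /=|s s0|s ->//]; last by rewrite leNgt (le_lt_trans s0).
case: (leP 1 s) => s1 nW.
  have [Wx Wy] := (spec_le_nbhs xy nW, nbhs_singleton nW).
  suff : \forall u \near s, W (if 1 <= u then y else x) by [].
  by apply: (@nearW _ (nbhs s)) => u; case: ifP.
suff : \forall u \near s, W (if 1 <= u then y else x) by [].
have : \forall u \near s, u < 1 by exact: lt_nbhsl.
by apply: filterS => u u1; rewrite leNgt u1 /=; exact: nbhs_singleton.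
Qed.

Definition edge x y (xy : le x y) : Pi x y := pcls (edge_is_path xy).

(** Slow the path down so that it runs during the middle third only, and from time
    [1/2] on replace that third by the constant [z]. This is continuous since
    every neighbourhood of [z] contains all points below [z]. What remains at
    time 1 depends on the ends only. *)
Lemma cone_homotopic z x y (g h : R -> X) : is_path x y g -> is_path x y h ->
  (forall s, le (g s) z) -> (forall s, le (h s) z) -> path_homotopic x y g h.
Proof.
have zeta (k : R -> X) : is_path x y k -> (forall s, le (k s) z) ->
    path_homotopic x y k (fun s => if 3 * s < 1 then x else if 3 * s <= 2 then z else y).
  move=> pk kz; have [ck k0 k1] := pk.
  pose k' s := k (3 * s - 1).
  have ck' : continuous k' by apply: (cts_comp _ ck); cts.
  have pk' : is_path x y k'.
    by split=> // s s1; rewrite /k'; [rewrite k0 //|rewrite k1 //]; lra.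
  apply: (@path_homotopic_trans _ _ _ _ _ k').
    apply: (@path_homotopic_param _ _ x y k k k' (fun s => s)
      (fun s => clamp (3 * s - 1))) => //.
    - by cts.
    - by apply: (cts_comp _ clamp_cts); cts.
    - by rewrite clamp_le0 //; lra.
    - by rewrite clamp_ge1 //; lra.
    - by move=> s _; rewrite (path_clamp _ pk).
  (* The closed set of times and parameters at which the homotopy equals [z]. *)
  pose C (p : R * R) := (1 <= 2 * p.1) && (1 <= 3 * p.2 <= 2).
  have cH : continuous (fun p => if C p then z else k' p.2).
    move=> p W /=; case: (boolP (C p)) => Cp nW.
      suff : \forall q \near p, W (if C q then z else k' q.2) by [].
      apply: (@nearW _ (nbhs p)) => q; case: ifP => _; first exact: nbhs_singleton nW.
      exact: spec_le_nbhs (kz _) nW.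
    have nk : \forall q \near p, W (k' q.2).
      by apply: (cts_comp (cts_snd (@cts_id _)) ck').
    have nC : \forall q \near p, ~~ C q.
      have c1 : continuous (fun q : R * R => 2 * q.1) by cts.
      have c2 : continuous (fun q : R * R => 3 * q.2) by cts.
      move: Cp; rewrite /C !negb_and -!ltNge => /or3P[] hC.
      - have : \forall q \near p, 2 * q.1 < 1 by exact: (c1 p _ (lt_nbhsl hC)).
        by apply: filterS => q hq; rewrite /C !negb_and -!ltNge hq.
      - have : \forall q \near p, 3 * q.2 < 1 by exact: (c2 p _ (lt_nbhsl hC)).
        by apply: filterS => q hq; rewrite /C !negb_and -!ltNge hq orbT.
      - have : \forall q \near p, 2 < 3 * q.2 by exact: (c2 p _ (lt_nbhsr hC)).
        by apply: filterS => q hq; rewrite /C !negb_and -!ltNge hq !orbT.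
    suff : \forall q \near p, W (if C q then z else k' q.2) by [].
    by apply: filterS2 nk nC => q Wq /negbTE->.
  exists (fun p => if C p then z else k' p.2); split=> [|s|s|t].
  - exact: cH.
  - by rewrite /C /= mulr0 ler10.
  - rewrite /C /= mulr1 ler1n /=; have [s1|s1] := ltP (3 * s) 1.
      by rewrite /k' k0 //; lra.
    by case: (leP (3 * s) 2) => // s2; rewrite /k' k1 //; lra.
  - split=> [|s s0|s s1].
    + by apply: (cts_comp (f := fun s => (t, s)) _ cH); cts.
    + by rewrite /C /=; (have -> : (1 <= 3 * s) = false by lra); rewrite /= andbF /k' k0 //; lra.
    + by rewrite /C /=; (have -> : (3 * s <= 2) = false by lra); rewrite !andbF /k' k1 //; lra.
move=> pg ph gz hz; apply: path_homotopic_trans (zeta g pg gz) _.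
exact: path_homotopic_sym (zeta h ph hz).
Qed.

Definition in_cone z x y (a : Pi x y) :=
  exists g, exists pg : is_path x y g, a = pcls pg /\ forall s, le (g s) z.

Lemma in_cone_eq z x y (a b : Pi x y) : in_cone z a -> in_cone z b -> a = b.
Proof.
move=> [g [pg [-> gz]]] [h [ph [-> hz]]]; apply/pcls_eqP.
exact: cone_homotopic gz hz.
Qed.

Lemma in_cone_cat z x y w (a : Pi x y) (b : Pi y w) :
  in_cone z a -> in_cone z b -> in_cone z (Pcat a b).
Proof.
move=> [g [pg [-> gz]]] [h [ph [-> hz]]]; rewrite Pcat_cls.
exists (pcat g h), (pcat_path pg ph); split=> // s.
by rewrite /pcat; case: ifP.
Qed.

Lemma in_cone1 z x : le x z -> in_cone z (Pone x).
Proof. by move=> xz; exists (fun _ => x), (cst_path x). Qed.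

Lemma in_cone_edge z x y (xy : le x y) : le y z -> in_cone z (edge xy).
Proof.
move=> yz; exists _, (edge_is_path xy); split=> // s; case: ifP => // _.
exact: spec_le_trans yz.
Qed.

Section order_two.
Hypothesis plX : @projective_like R X.
Variable x0 : X.

Definition nontrivial x (a : Pi x x) : bool := `[< a <> Pone x >].

Lemma order2_cat (a b : Pi x0 x0) :
  nontrivial (Pcat a b) = nontrivial a (+) nontrivial b.
Proof.
have [_ _ /(_ x0)[g g1 gP]] := plX.
have n1 : nontrivial (Pone x0) = false by apply/asboolP.
have ng : nontrivial g by apply/asboolP.
have gg : Pcat g g = Pone x0.
  case: (gP (Pcat g g)) => // e; exfalso; apply: g1.
  by have := congr1 (Pcat (Pinv g)) e; rewrite PcatA PVcat P1cat.
case: (gP a) => ->; case: (gP b) => ->; rewrite ?P1cat ?Pcat1 ?gg n1 ?ng //.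
Qed.

Let conn x : exists a : Pi x0 x, True.
Proof. by have [_ + _] := plX; exact. Qed.

Definition base_path x : Pi x0 x := sval (cid (conn x)).

(** The class in Z/2 of the loop formed by [a] and the chosen paths from [x0]. *)
Definition twist x y (a : Pi x y) : bool :=
  nontrivial (Pcat (base_path x) (Pcat a (Pinv (base_path y)))).

Lemma twist_cat x y z (a : Pi x y) (b : Pi y z) :
  twist (Pcat a b) = twist a (+) twist b.
Proof.
rewrite /twist -order2_cat; congr nontrivial.
by rewrite -!PcatA (PcatA (Pinv _) (base_path y)) PVcat P1cat.
Qed.

Lemma twist1 x : twist (Pone x) = false.
Proof. by have := twist_cat (Pone x) (Pone x); rewrite P1cat addbb. Qed.

Lemma twist_loop (a : Pi x0 x0) : a <> Pone x0 -> twist a.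
Proof.
move=> a1; apply/asboolP => e; apply: a1.
have := congr1 (fun u => Pcat (Pinv (base_path x0)) (Pcat u (base_path x0))) e.
by rewrite P1cat PVcat -!PcatA PVcat Pcat1 PcatA PVcat P1cat.
Qed.

Definition edge_twist x y : bool :=
  if pselect (le x y) is left xy then twist (edge xy) else false.

Lemma edge_twistE x y (xy : le x y) : edge_twist x y = twist (edge xy).
Proof.
rewrite /edge_twist; case: pselect => // xy'.
by rewrite (Prop_irrelevance xy xy').
Qed.

(** The three edges lie below [z], so the composite of two of them is the third. *)
Lemma edge_twistD x y z : le x y -> le y z ->
  edge_twist x y (+) edge_twist y z = edge_twist x z.
Proof.
move=> xy yz; have xz := spec_le_trans xy yz.
rewrite (edge_twistE xy) (edge_twistE yz) (edge_twistE xz) -twist_cat.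
congr twist; apply: (@in_cone_eq z); last exact: in_cone_edge (spec_le_refl z).
by apply: in_cone_cat; apply: in_cone_edge => //; exact: spec_le_refl.
Qed.

Lemma integral_twist : (#|` fset_set [set: X]| <= 12)%N -> exists c : X -> X -> int,
  (forall x y, le x y -> oddz (c x y) = edge_twist x y) /\
  (forall x y z, le x y -> le y z -> c x y + c y z = c x z).
Proof.
set F := fset_set [set: X] => F12.
have inF x : x \in F by rewrite in_fset_set // inE.
have [||||c [cs cD]] := @integral_cocycle F (fun u v => le (val u) (val v)) _ _
   (fun u v => edge_twist (val u) (val v)).
- by move=> u; exact: spec_le_refl.
- by move=> u v w; exact: spec_le_trans.
- by move=> u v w; exact: edge_twistD.
- by rewrite -cardfE.
exists (fun x y => c [` inF x]%fset [` inF y]%fset); split=> [x y xy|x y z xy yz].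
  exact: cs.
exact: cD.
Qed.

Section winding.
Variable c : X -> X -> int.
Hypothesis c_twist : forall x y, le x y -> oddz (c x y) = edge_twist x y.
Hypothesis cD : forall x y z, le x y -> le y z -> c x y + c y z = c x z.

Lemma cocycle_refl x : c x x = 0.
Proof.
by have /(canRL (addrK _)) := cD (spec_le_refl x) (spec_le_refl x); rewrite subrr.
Qed.

(** [b] is a lift of [g] to the covering space with integer fibres that the
    cocycle [c] defines; [b 1 - b 0] is the winding number of [g]. *)
Definition winding (g : R -> X) (b : R -> int) := forall s : R, 0 <= s <= 1 ->
  \forall r \near s, 0 <= r <= 1 -> b r - b s = - c (g r) (g s).

(** The covering space restricted to a square is trivial, which is what makes the
    winding number homotopy invariant. *)
Lemma square_winding (H : R * R -> X) : continuous H -> exists a : R * R -> int,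
  forall z : R * R, 0 <= z.1 <= 1 -> 0 <= z.2 <= 1 ->
  \forall w \near z, 0 <= w.1 <= 1 -> 0 <= w.2 <= 1 ->
    a w - a z = - c (H w) (H z).
Proof.
move=> cH; apply: (@monodromy R int (fun z w : R * R => - c (H w) (H z))) => z0.
have nH (z : R * R) : \forall w \near z, le (H w) (H z) by exact: (cH z _ (near_spec_le (H z))).
apply: filterS (nH z0) => z zz0; apply: filterS (nH z) => w wz.
by rewrite -(cD wz zz0) opprK opprD subrK.
Qed.

Lemma winding_slice (H : R * R -> X) (a : R * R -> int) (l : R -> R * R) :
    (forall z : R * R, 0 <= z.1 <= 1 -> 0 <= z.2 <= 1 ->
      \forall w \near z, 0 <= w.1 <= 1 -> 0 <= w.2 <= 1 ->
      a w - a z = - c (H w) (H z)) ->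
    continuous l ->
    (forall s, 0 <= s <= 1 -> 0 <= (l s).1 <= 1 /\ 0 <= (l s).2 <= 1) ->
  winding (fun s => H (l s)) (fun s => a (l s)).
Proof.
move=> aP cl l01 s s01; have [l1 l2] := l01 s s01.
have n : \forall r \near s, 0 <= (l r).1 <= 1 -> 0 <= (l r).2 <= 1 ->
    a (l r) - a (l s) = - c (H (l r)) (H (l s)) by exact: (cl s _ (aP _ l1 l2)).
by apply: filterS n => r h r01; have [r1 r2] := l01 r r01; apply: h.
Qed.

Lemma winding_unique (g : R -> X) b b' : winding g b -> winding g b' ->
  b 1 - b 0 = b' 1 - b' 0.
Proof.
move=> bP b'P; apply: subr_swap.
apply: (@locally_constant01 _ _ (fun s => b s - b' s)); last by rewrite ler01 lexx.
move=> s s01; have n1 := bP s s01; have n2 := b'P s s01.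
by apply: filterS2 n1 n2 => r h h' r01; apply: subr_swap; rewrite h // h'.
Qed.

Lemma winding_cst (g : R -> X) x b : (forall s, g s = x) -> winding g b -> b 1 = b 0.
Proof.
move=> gx bP; have b0 : winding g (fun _ => 0).
  by move=> s s01; near=> r => _; rewrite !gx cocycle_refl subrr oppr0.
have := winding_unique bP b0; rewrite subrr => /eqP; rewrite subr_eq0 => /eqP.
exact.
Unshelve. all: by end_near.
Qed.

(** Both sides are additive along [g], and they agree on a short piece of [g]:
    near a parameter [t] all points of [g] lie below [g t], so the piece is
    homotopic to an edge of the preorder. *)
Lemma winding_parity x y (g : R -> X) (pg : is_path x y g) b :
  winding g b -> oddz (b 1 - b 0) = twist (pcls pg).
Proof.
move=> bP; have [cg g0 g1] := pg.
have ex : x = g 0 by rewrite g0.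
have ey : y = g 1 by rewrite g1.
subst x y.
pose f (t : R) := twist (pcls (seg_path 0 t cg)) (+) oddz (b t - b 0).
have f1 : f 1 = f 0.
  apply: (@locally_constant01 _ _ f); last by rewrite ler01 lexx.
  move=> t t01.
  have /nbhs_ballP[e /= e0 eg] : \forall u \near t, le (g u) (g t).
    exact: (cg t _ (near_spec_le (g t))).
  have nb : \forall u \near t, ball t e u by exact: near_ball.
  apply: filterS2 nb (bP t t01) => u tu bu u01; have ut := eg u tu.
  rewrite /f -(seg_cat 0 t u cg) twist_cat -addbA; congr addb.
  have cone_seg : in_cone (g t) (pcls (seg_path t u cg)).
    exists (seg g t u), (seg_path t u cg); split=> // s; apply: eg.
    have /andP[s0 s1] := @clamp01 R s; move: tu; rewrite /ball /= !ltr_distlC.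
    by move=> /andP[tu1 tu2]; apply/andP; split; nra.
  have cone_edge := in_cone_edge ut (spec_le_refl (g t)).
  have := in_cone_eq (in_cone_cat cone_seg cone_edge) (in_cone1 (spec_le_refl (g t))).
  move=> /(congr1 (@twist _ _)); rewrite twist_cat twist1 -(edge_twistE ut).
  rewrite -c_twist // => e1.
  have -> : b u - b 0 = - c (g u) (g t) + (b t - b 0) by rewrite -bu // addrA subrK.
  by rewrite [oddz (- _ + _)]oddzD oddzN addbA e1.
move: f1; rewrite /f subrr.
have -> : pcls (seg_path 0 0 cg) = Pone (g 0).
  apply: (@in_cone_eq (g 0)); last exact: in_cone1 (spec_le_refl _).
  exists (seg g 0 0), (seg_path 0 0 cg); split=> // s.
  by rewrite /seg subrr mul0r addr0; exact: spec_le_refl.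
have -> : pcls (seg_path 0 1 cg) = pcls pg.
  apply/pcls_eqP; suff -> : seg g 0 1 = g by exact: path_homotopic_refl.
  by apply/funext => s; rewrite /seg add0r subr0 mul1r (path_clamp _ pg).
rewrite twist1 /= (_ : oddz 0 = false) //.
by case: (twist _) (oddz _) => [] [].
Qed.

(** Lift a null-homotopy of the nontrivial loop followed by itself. The lift is
    constant on three sides of the square, so the winding number of the fourth
    side is zero. It is also twice the winding number of the loop, which is odd. *)
Lemma no_integral_cocycle : False.
Proof.
have [_ _ /(_ x0)[a a1 aP]] := plX.
have aa : Pcat a a = Pone x0.
  case: (aP (Pcat a a)) => // e; exfalso; apply: a1.
  by have := congr1 (Pcat (Pinv a)) e; rewrite PcatA PVcat P1cat.
have ta := twist_loop a1.
have [g [pg ag]] := pclsP a; subst a.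
move: aa; rewrite Pcat_cls => /pcls_eqP[H [cH H0 H1 Hp]].
have [w wP] := square_winding cH.
have i01 : 0 <= (0 : R) <= 1 by rewrite lexx ler01.
have i11 : 0 <= (1 : R) <= 1 by rewrite lexx ler01.
have side (l : R -> R * R) x : continuous l ->
    (forall s, 0 <= s <= 1 -> 0 <= (l s).1 <= 1 /\ 0 <= (l s).2 <= 1) ->
    (forall s, H (l s) = x) -> w (l 1) = w (l 0).
  move=> cl l01 Hl; apply: (winding_cst (g := fun s => H (l s)) (x := x) (b := fun s => w (l s))) => //.
  exact: winding_slice.
have s0 : w (1, 0) = w (0, 0).
  apply: (side (fun t => (t, 0)) x0) => [|s s01|s] //=; first by cts.
  by have [_ e _] := Hp s; exact: e (lexx 0).
have s1 : w (1, 1) = w (0, 1).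
  apply: (side (fun t => (t, 1)) x0) => [|s s01|s] //=; first by cts.
  by have [_ _ e] := Hp s; exact: e (lexx 1).
have s2 : w (1, 1) = w (1, 0).
  by apply: (side (fun s => (1, s)) x0) => [|s s01|s] //=; first by cts.
have bP : winding (pcat g g) (fun s => w (0, s)).
  have := winding_slice (l := fun s => (0, s)) wP _ _.
  rewrite (_ : (fun s => H (0, s)) = pcat g g); last by apply/funext => s; rewrite H0.
  by apply; [cts|].
(* Either half of the fourth side is a lift of [g]. *)
have half (l : R -> R) : continuous l -> (forall s, 0 <= s <= 1 -> 0 <= l s <= 1) ->
    (forall s, 0 <= s <= 1 -> pcat g g (l s) = g s) -> winding g (fun s => w (0, l s)).
  move=> cl l01 gl s s01.
  have n : \forall r \near s, 0 <= l r <= 1 ->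
      w (0, l r) - w (0, l s) = - c (pcat g g (l r)) (pcat g g (l s)).
    exact: (cl s _ (bP _ (l01 s s01))).
  by apply: filterS n => r h r01; rewrite h ?l01 // !gl.
have [_ g0 g1] := pg.
have b1 : winding g (fun s => w (0, s / 2)).
  apply: half => [|s s01|s s01]; [by cts|lra|].
  by rewrite /pcat; (have -> : s / 2 - 2^-1 <= 0 by lra); congr g; lra.
have b2 : winding g (fun s => w (0, (s + 1) / 2)).
  apply: half => [|s s01|s s01]; [by cts|lra|].
  rewrite /pcat; case: ifP => s2'.
    by rewrite g1 ?g0 //; lra.
  by congr g; lra.
have e := winding_unique b1 b2.
have p1 := winding_parity pg b1; rewrite ta in p1.
move: e p1; rewrite add0r mul0r (_ : (1 + 1) / 2 = 1 :> R); last lra.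
rewrite -s0 -s2 s1 => e p1.
have z : w (0, 1 / 2) = w (0, 1).
  by move: e; clear; move: (w _) (w _) => a b; lia.
by move: p1; rewrite z subrr.
Qed.

End winding.
End order_two.

Lemma projective_like_card x0 : @projective_like R X -> (13 <= #|` fset_set [set: X]|)%N.
Proof.
move=> plX; rewrite leqNgt ltnS; apply/negP => X12.
have [c [c_twist cD]] := integral_twist plX x0 X12.
exact: no_integral_cocycle plX x0 c c_twist cD.
Qed.

End finite_spaces.

(** * Scalar products and normalization *)

Section dot_product.
Context {R : realType} {n : nat}.
Implicit Types (u v w : 'rV[R]_n) (c : R).

Definition dot u v : R := \sum_i u 0 i * v 0 i.

Lemma dotC u v : dot u v = dot v u.
Proof. by apply: eq_bigr => i _; rewrite mulrC. Qed.

Lemma dotDl u v w : dot (u + v) w = dot u w + dot v w.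
Proof. by rewrite -big_split; apply: eq_bigr => i _; rewrite mxE mulrDl. Qed.

Lemma dotZl c u w : dot (c *: u) w = c * dot u w.
Proof. by rewrite mulr_sumr; apply: eq_bigr => i _; rewrite mxE mulrA. Qed.

Lemma dotNl u w : dot (- u) w = - dot u w.
Proof. by rewrite -scaleN1r dotZl mulN1r. Qed.

Lemma dotDr u v w : dot w (u + v) = dot w u + dot w v.
Proof. by rewrite dotC dotDl !(dotC w). Qed.

Lemma dotZr c u w : dot w (c *: u) = c * dot w u.
Proof. by rewrite dotC dotZl (dotC w). Qed.

Lemma dotNr u w : dot w (- u) = - dot w u.
Proof. by rewrite dotC dotNl (dotC w). Qed.

Lemma dot_ge0 u : 0 <= dot u u.
Proof. by apply: sumr_ge0 => i _; rewrite -expr2 sqr_ge0. Qed.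

Lemma dot_eq0 u : (dot u u == 0) = (u == 0).
Proof.
apply/idP/eqP => [|->]; last by rewrite /dot big1 // => i _; rewrite mxE mul0r.
rewrite psumr_eq0 => [/allP u0|i _]; last by rewrite -expr2 sqr_ge0.
apply/rowP => i; have := u0 i; rewrite mem_index_enum mulf_eq0 orbb => /(_ isT)/eqP->.
by rewrite mxE.
Qed.

Lemma unit_dot_lt u v : dot u u = 1 -> dot v v = 1 -> u != v -> dot u v < 1.
Proof.
move=> uu vv uv; have : 0 < dot (u - v) (u - v).
  by rewrite lt_neqAle dot_ge0 eq_sym dot_eq0 subr_eq0 uv.
by rewrite !(dotDl, dotDr, dotNl, dotNr) uu vv (dotC v); lra.
Qed.

Lemma unit_dot_gt u v : dot u u = 1 -> dot v v = 1 -> u != - v -> -1 < dot u v.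
Proof.
move=> uu vv uv; have := @unit_dot_lt u (- v) uu.
by rewrite !(dotNl, dotNr) opprK => /(_ vv uv); lra.
Qed.

Section continuity.
Context {T : topologicalType}.

Lemma cts_scale (f : T -> R) (g : T -> 'rV[R]_n) : continuous f -> continuous g ->
  continuous (fun x => f x *: g x).
Proof.
move=> cf cg; apply: cts_mx => i j.
rewrite (_ : (fun x => _) = (fun x => f x * g x i j)).
  by have := cts_coord (i := i) (j := j) cg => ?; cts.
by apply/funext => x; rewrite mxE.
Qed.

Lemma cts_addv (f g : T -> 'rV[R]_n) : continuous f -> continuous g ->
  continuous (fun x => f x + g x).
Proof.
move=> cf cg; apply: cts_mx => i j.
rewrite (_ : (fun x => _) = (fun x => f x i j + g x i j)).
  by have := cts_coord (i := i) (j := j) cg; have := cts_coord (i := i) (j := j) cf => ? ?; cts.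
by apply/funext => x; rewrite mxE.
Qed.

Lemma cts_oppv (f : T -> 'rV[R]_n) : continuous f -> continuous (fun x => - f x).
Proof.
move=> cf; rewrite (_ : (fun x => _) = (fun x => (-1) *: f x)).
  by apply: cts_scale => //; cts.
by apply/funext => x; rewrite scaleN1r.
Qed.

Lemma cts_dot (f g : T -> 'rV[R]_n) : continuous f -> continuous g ->
  continuous (fun x => dot (f x) (g x)).
Proof.
move=> cf cg; rewrite /dot; elim: (index_enum _) => [|i l IH].
  rewrite (_ : (fun x => _) = (fun=> 0)); first by cts.
  by apply/funext => x; rewrite big_nil.
rewrite (_ : (fun x => _) = (fun x => f x 0 i * g x 0 i +
    \sum_(j <- l) f x 0 j * g x 0 j)).
  by have := cts_coord (i := 0) (j := i) cg; have := cts_coord (i := 0) (j := i) cf => ? ?; cts.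
by apply/funext => x; rewrite big_cons.
Qed.

End continuity.
End dot_product.

Section sphere.
Context {R : realType}.
Local Notation S := (sphere R 2).
Implicit Types (x y z : S) (u v w : 'rV[R]_3).

Lemma sphereP u : reflect (dot u u = 1) (u \in S).
Proof.
apply: (iffP idP); rewrite inE /sphere /= /dot => e;
  by rewrite -[RHS]e; apply: eq_bigr => i _; rewrite expr2.
Qed.

Lemma sphere_dot x : dot (val x) (val x) = 1.
Proof. exact/sphereP/(valP x). Qed.

Definition normalize u := (Num.sqrt (dot u u))^-1 *: u.

Lemma normalize_sphere u : u != 0 -> normalize u \in S.
Proof.
move=> u0; apply/sphereP; rewrite dotZl dotZr mulrA -invfM -expr2 sqr_sqrtr ?dot_ge0 //.
by rewrite mulVf // dot_eq0.
Qed.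

Lemma pole_subproof : (const_mx 1 : 'rV[R]_3) != 0.
Proof. by apply/eqP => /rowP/(_ 0); rewrite !mxE => /eqP; rewrite oner_eq0. Qed.

Definition to_sphere u : S :=
  insubd (SigSub (normalize_sphere pole_subproof) : S) (normalize u).

Lemma val_to_sphere u : u != 0 -> val (to_sphere u) = normalize u.
Proof. by move=> u0; rewrite insubdK //; exact: normalize_sphere. Qed.

Lemma to_sphereK c x : 0 < c -> to_sphere (c *: val x) = x.
Proof.
move=> c0; have x0 : val x != 0 by rewrite -dot_eq0 sphere_dot oner_eq0.
apply: val_inj; rewrite val_to_sphere; last by rewrite scaler_eq0 negb_or gt_eqF.
rewrite /normalize dotZl dotZr sphere_dot mulr1 -expr2 sqrtr_sqr gtr0_norm //.
by rewrite scalerA mulVf ?scale1r // gt_eqF.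
Qed.

Lemma cts_to_sphere_at (T : topologicalType) (f : T -> 'rV[R]_3) (t : T) :
  {for t, continuous f} -> f t != 0 -> {for t, continuous (fun s => to_sphere (f s))}.
Proof.
move=> cf ft0 W [V [[U oU UV] Vt] VW].
have cn : {for t, continuous (fun s => normalize (f s))}.
  have cd : {for t, continuous (fun s => dot (f s) (f s))}.
    apply: (@continuous_comp _ _ _ f (fun u => dot u u) t cf).
    by apply: cts_dot; cts.
  have dt0 : 0 < dot (f t) (f t) by rewrite lt_neqAle dot_ge0 eq_sym dot_eq0 ft0.
  have cs : {for t, continuous (fun s => (Num.sqrt (dot (f s) (f s)))^-1)}.
    apply: cvgV; first by rewrite gt_eqF // sqrtr_gt0.
    exact: (continuous_comp cd (@sqrt_continuous R _)).
  have cm : {for t, continuous (fun s => ((Num.sqrt (dot (f s) (f s)))^-1, f s))}.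
    exact: (cvg_pair cs cf).
  apply: (@continuous_comp _ _ _ _ (fun p : R * 'rV[R]_3 => p.1 *: p.2) t cm).
  by apply: cts_scale; [apply: cts_fst|apply: cts_snd]; cts.
have nU : \forall s \near t, U (normalize (f s)).
  apply: cn; apply: open_nbhs_nbhs; split=> //.
  by move: Vt; rewrite -UV /= set_valE val_to_sphere.
have n0 : \forall s \near t, f s != 0.
  have cd : {for t, continuous (fun s => dot (f s) (f s))}.
    apply: (@continuous_comp _ _ _ f (fun u => dot u u) t cf).
    by apply: cts_dot; cts.
  have dt0 : 0 < dot (f t) (f t) by rewrite lt_neqAle dot_ge0 eq_sym dot_eq0 ft0.
  have : \forall s \near t, 0 < dot (f s) (f s) by exact: (cd _ (lt_nbhsr dt0)).
  by apply: filterS => s; rewrite -dot_eq0 => /gt_eqF->.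
suff : \forall s \near t, W (to_sphere (f s)) by [].
apply: filterS2 nU n0 => s Us s0; apply: VW; rewrite -UV /=.
by rewrite set_valE val_to_sphere.
Qed.

Lemma cts_to_sphere (T : topologicalType) (f : T -> 'rV[R]_3) :
  continuous f -> (forall t, f t != 0) -> continuous (fun s => to_sphere (f s)).
Proof. by move=> cf f0 t; apply: cts_to_sphere_at => //; exact: cf. Qed.

Lemma cts_sphere_val (T : topologicalType) (f : T -> S) :
  continuous f -> continuous (fun t => val (f t)).
Proof. by move=> cf; apply: (cts_comp cf); exact: cts_val. Qed.

Lemma nonantipodal_neq0 x y (t : R) : 0 <= t <= 1 -> -1 < dot (val x) (val y) ->
  (1 - t) *: val x + t *: val y != 0.
Proof.
move=> t01 xy; rewrite -dot_eq0 !(dotDl, dotDr, dotZl, dotZr) !sphere_dot.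
rewrite (dotC (val y)) gt_eqF //; move: (dot _ _) xy => d d1.
have [->|t0] := eqVneq t 0; first lra.
have tp : 0 < t by rewrite lt_neqAle eq_sym t0; case/andP: t01.
have [->|t1] := eqVneq t 1; first lra.
have tq : 0 < 1 - t by rewrite subr_gt0 lt_neqAle t1; case/andP: t01.
have : 0 < t * (1 - t) * (1 + d) by rewrite !mulr_gt0 //; lra.
have : 0 <= (1 - 2 * t) ^+ 2 by exact: sqr_ge0.
by nra.
Qed.

(** The segment between two vectors that are not opposite misses the origin, so
    it can be projected to the sphere. *)
Lemma nonantipodal_homotopic x y (g h : R -> S) : is_path x y g -> is_path x y h ->
  (forall s, -1 < dot (val (g s)) (val (h s))) -> path_homotopic x y g h.
Proof.
move=> [cg g0 g1] [ch h0 h1] gh.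
have cH : continuous (fun p : R * R => to_sphere
    ((1 - clamp p.1) *: val (g p.2) + clamp p.1 *: val (h p.2))).
  apply: cts_to_sphere => [|p]; last by apply: nonantipodal_neq0; rewrite ?clamp01.
  have c1 : continuous (fun p : R * R => clamp p.1) by apply: (cts_comp _ clamp_cts); cts.
  have c2 : continuous (fun p : R * R => val (g p.2)).
    by apply: cts_sphere_val; apply: (cts_comp _ cg); cts.
  have c3 : continuous (fun p : R * R => val (h p.2)).
    by apply: cts_sphere_val; apply: (cts_comp _ ch); cts.
  by apply: cts_addv; apply: cts_scale => //; cts.
exists (fun p => to_sphere ((1 - clamp p.1) *: val (g p.2) + clamp p.1 *: val (h p.2))).
split=> [|s|s|t] //=.
- by rewrite clamp_le0 // subr0 scale0r addr0 to_sphereK.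
- by rewrite clamp_ge1 // subrr scale0r add0r to_sphereK.
split=> [|s s0|s s1].
- by apply: (cts_comp (f := fun s => (t, s)) _ cH); cts.
- by rewrite g0 // h0 // -scalerDl subrK to_sphereK.
- by rewrite g1 // h1 // -scalerDl subrK to_sphereK.
Qed.

End sphere.

(** * The sphere is simply connected *)

Section simply_connected_sphere.
Context {R : realType}.
Local Notation S := (sphere R 2).
Local Notation Pi := (@Pi R S).
Implicit Types (x y z : S) (u v w : 'rV[R]_3).

Lemma orthogonal_vector u v : exists2 w, w != 0 & dot u w = 0 /\ dot v w = 0.
Proof.
pose A := (col_mx u v)^T.
have : kermx A != 0.
  rewrite kermx_eq0 /row_free; apply/negP => /eqP rA.
  by have := rank_leq_col A; rewrite rA.
move=> /rowV0Pn[w wA w0]; exists w => //.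
have : w *m A = 0 by apply/sub_kermxP.
rewrite /A tr_col_mx mul_mx_row => /eqP; rewrite -row_mx0 => /eqP/eq_row_mx[wu wv].
have dotE (a b : 'rV[R]_3) : (a *m b^T) 0 0 = dot a b.
  by rewrite mxE; apply: eq_bigr => i _; rewrite mxE.
by rewrite (dotC u) (dotC v) -!dotE wu wv !mxE.
Qed.

Definition arc x y (s : R) : S :=
  to_sphere ((1 - clamp s) *: val x + clamp s *: val y).

Lemma arc_path x y : -1 < dot (val x) (val y) -> is_path x y (arc x y).
Proof.
move=> xy; split=> [|s s0|s s1].
- apply: cts_to_sphere => [|s]; last by apply: nonantipodal_neq0; rewrite ?clamp01.
  have c1 : continuous (fun s : R => clamp s) by exact: clamp_cts.
  by apply: cts_addv; apply: cts_scale => //; cts.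
- by rewrite /arc clamp_le0 // subr0 scale0r addr0 to_sphereK.
- by rewrite /arc clamp_ge1 // subrr scale0r add0r to_sphereK.
Qed.

Lemma dot_to_sphere u v : u != 0 -> v != 0 -> 0 < dot u v ->
  0 < dot (val (to_sphere u)) v.
Proof.
move=> u0 v0 uv; rewrite val_to_sphere // dotZl mulr_gt0 // invr_gt0 sqrtr_gt0.
by rewrite lt_neqAle dot_ge0 eq_sym dot_eq0 u0.
Qed.

Definition in_planes (l : seq 'rV[R]_3) x := exists2 w, w \in l & dot (val x) w = 0.

(** Classes of paths that run inside finitely many planes through the origin. An
    arbitrary path may fill the sphere; these cannot. *)
Definition planar x y (a : Pi x y) := exists l : seq 'rV[R]_3,
  (forall w, w \in l -> w != 0) /\
  exists g, exists pg : is_path x y g, a = pcls pg /\ forall s, in_planes l (g s).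

Lemma planar_cat x y z (a : Pi x y) (b : Pi y z) :
  planar a -> planar b -> planar (Pcat a b).
Proof.
move=> [l [l0 [g [pg [-> gl]]]]] [m [m0 [h [ph [-> hm]]]]].
exists (l ++ m); split=> [w|]; first by rewrite mem_cat => /orP[/l0|/m0].
exists (pcat g h), (pcat_path pg ph); rewrite Pcat_cls; split=> // s.
rewrite /pcat; case: ifP => _.
  by have [w wl e] := gl (2 * s); exists w; rewrite // mem_cat wl.
by have [w wm e] := hm (2 * s - 1); exists w; rewrite // mem_cat wm orbT.
Qed.

(** A path whose points are pairwise at less than a right angle is homotopic to
    the arc of a great circle between its ends, which is never opposite to it. *)
Lemma planar_small x y (g : R -> S) (pg : is_path x y g) :
  (forall s t, 0 < dot (val (g s)) (val (g t))) -> planar (pcls pg).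
Proof.
move=> gg; have [_ g0 g1] := pg.
have [w w0 [xw yw]] := orthogonal_vector (val x) (val y).
have xy : -1 < dot (val x) (val y).
  by have := gg 0 1; rewrite (g0 0) ?(g1 1) ?lexx //; lra.
exists [:: w]; split=> [w'|]; first by rewrite inE => /eqP->.
exists (arc x y), (arc_path xy); split.
  apply/pcls_eqP/nonantipodal_homotopic => // [|s]; first exact: arc_path.
  have /andP[s0 s1] := @clamp01 R s.
  have n0 := nonantipodal_neq0 (@clamp01 R s) xy.
  rewrite dotC; apply: lt_trans (_ : 0 < _); first lra.
  apply: dot_to_sphere => //.
    by rewrite -dot_eq0 sphere_dot oner_eq0.
  rewrite dotDl !dotZl; have := gg 0 s; have := gg 1 s; rewrite (g0 0) ?(g1 1) ?lexx //.
  by move=> d1 d2; nra.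
move=> s; exists w; rewrite ?inE // /arc val_to_sphere.
  by rewrite /normalize dotZl [dot (_ + _) w]dotDl !(dotZl _ _ w) xw yw !mulr0 addr0 mulr0.
exact: nonantipodal_neq0 (@clamp01 R s) xy.
Qed.

(** Short pieces are planar by [planar_small], with a uniform bound for short;
    joining two pieces doubles the length. *)
Lemma planar_all x y (a : Pi x y) : planar a.
Proof.
have [g [pg ->]] := pclsP a; have [cg g0 g1] := pg.
have ex : x = g 0 by rewrite g0.
have ey : y = g 1 by rewrite g1.
subst x y.
have [e e0 ge] : exists2 e : R, 0 < e & forall s : R, `[0, 1]%classic s ->
    forall t u : R, ball s e t -> ball s e u -> 0 < dot (val (g t)) (val (g u)).
  apply: (@lebesgue_number R R `[0, 1]%classic (fun A => forall t u : R, A t -> A u ->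
    0 < dot (val (g t)) (val (g u)))).
  - exact: segment_compact.
  - by move=> A B AB gB t u /AB tB /AB uB; apply: gB.
  - move=> s _; pose d (p : R * R) := dot (val (g p.1)) (val (g p.2)).
    have cd : continuous d.
      by apply: cts_dot; apply: cts_sphere_val; apply: (cts_comp _ cg); cts.
    have ds : 0 < d (s, s) by rewrite /d sphere_dot.
    have /nbhs_ballP[e /= e0 eP] : \forall p \near (s, s), 0 < d p.
      exact: (cd (s, s) _ (lt_nbhsr ds)).
    by exists e => // t u st su; apply: (eP (t, u)).
have small k (t d : R) : 0 <= d -> d <= 2 ^+ k * (e / 2) -> 0 <= t -> t + d <= 1 ->
    planar (pcls (seg_path t (t + d) cg)).
  elim: k t d => [|k IH] t d d0 dk t0 td.
    apply: planar_small => r s.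
    apply: (ge t); first by rewrite /= in_itv /= t0 /=; lra.
      rewrite /ball /= ltr_distlC; have /andP[r0 r1] := @clamp01 R r.
      by rewrite expr0 mul1r in dk; apply/andP; split; nra.
    rewrite /ball /= ltr_distlC; have /andP[s0 s1] := @clamp01 R s.
    by rewrite expr0 mul1r in dk; apply/andP; split; nra.
  have dk' : d / 2 <= 2 ^+ k * (e / 2) by move: dk; rewrite exprS; lra.
  rewrite -(seg_cat t (t + d / 2) (t + d) cg).
  apply: planar_cat; first by apply: IH => //; lra.
  have -> : t + d = t + d / 2 + d / 2 by lra.
  by apply: IH => //; lra.
have [k ke] : exists k, 1 <= 2 ^+ k * (e / 2).
  exists (Num.bound (2 / e)).
  have h : 2 / e < 2 ^+ (Num.bound (2 / e)).
    apply: lt_le_trans (_ : (Num.bound (2 / e))%:R <= _).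
      by apply: archi_boundP; rewrite divr_ge0 // ltW.
    by rewrite -natrX ler_nat ltnW // ltn_expl.
  by move: h; rewrite ltr_pdivrMr //; lra.
have : planar (pcls (seg_path 0 (0 + 1) cg)) by apply: (small k); lra.
have -> : 0 + 1 = 1 :> R by rewrite add0r.
have -> // : pcls (seg_path 0 1 cg) = pcls pg.
apply/pcls_eqP; suff -> : seg g 0 1 = g by exact: path_homotopic_refl.
by apply/funext => s; rewrite /seg add0r subr0 mul1r (path_clamp _ pg).
Qed.

(** The curve [(1, t, t ^ 2)] meets each plane at the roots of a nonzero
    polynomial in [t], so some point of the curve avoids all of them. *)
Lemma off_planes (l : seq 'rV[R]_3) : (forall w, w \in l -> w != 0) ->
  exists z, ~ in_planes l z.
Proof.
move=> l0.
pose p (w : 'rV[R]_3) : {poly R} := \poly_(i < 3) w 0 (inord i).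
have p0 w : w != 0 -> p w != 0.
  apply: contra => /eqP pw; apply/eqP/rowP => i.
  have := congr1 (fun q : {poly R} => q`_i) pw.
  by rewrite coef_poly ltn_ord coef0 inord_val mxE.
pose m (t : R) : 'rV[R]_3 := \row_i t ^+ i.
have pm w t : (p w).[t] = dot (m t) w.
  rewrite horner_poly; apply: eq_bigr => i _.
  by rewrite mxE inord_val mulrC.
pose P := \prod_(w <- l) p w.
have P0 : P != 0.
  rewrite prodf_seq_neq0; apply/allP => w wl /=; exact: p0 (l0 _ wl).
have [t nt] : exists t, ~~ root P t.
  have : ~~ all (root P) [seq (n%:R : R) | n <- iota 0 (size P)].
    apply/negP => /(max_poly_roots P0); rewrite size_map size_iota ltnn => h.
    suff // : false by []. apply: h; rewrite map_inj_uniq ?iota_uniq // => i j /eqP.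
    by rewrite eqr_nat => /eqP.
  by move=> /allPn[t _ nt]; exists t.
have m0 : m t != 0.
  apply/eqP => /rowP/(_ 0); rewrite !mxE expr0 => /eqP; by rewrite oner_eq0.
exists (to_sphere (m t)) => -[w wl]; rewrite val_to_sphere // /normalize dotZl.
move=> /eqP; rewrite mulf_eq0 invr_eq0 sqrtr_eq0 -(pm w) => /orP[|/eqP e].
  by rewrite leNgt lt_neqAle dot_ge0 eq_sym dot_eq0 m0.
move: nt; rewrite /root /P horner_prod prodf_seq_eq0; apply/negP; rewrite negbK.
by apply/hasP; exists w => //=; rewrite e.
Qed.

Section stereographic.
Variable v : S.
Local Notation v' := (val v).

(** Stereographic projection from [v] to the plane orthogonal to [v]; [unstereo]
    is its inverse, where normalizing replaces the division by
    [dot w w + 1]. *)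
Definition stereo u : 'rV[R]_3 := (1 - dot u v')^-1 *: (u - dot u v' *: v').
Definition unstereo w : S := to_sphere (2 *: w + (dot w w - 1) *: v').

Lemma stereo_orth u : dot (stereo u) v' = 0.
Proof. by rewrite dotZl dotDl dotNl dotZl sphere_dot mulr1 subrr mulr0. Qed.

Lemma unstereo_neq0 w : dot w v' = 0 -> 2 *: w + (dot w w - 1) *: v' != 0.
Proof.
move=> wv; rewrite -dot_eq0 !(dotDl, dotDr, dotZl, dotZr) sphere_dot.
rewrite (dotC v') wv; have := dot_ge0 w; move: (dot w w) => a a0.
by rewrite gt_eqF //; nra.
Qed.

Lemma stereoK x : x != v -> unstereo (stereo (val x)) = x.
Proof.
move=> xv; pose d := dot (val x) v'.
have d1 : 0 < 1 - d.
  rewrite subr_gt0; apply: unit_dot_lt; rewrite ?sphere_dot //.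
have ss : dot (stereo (val x)) (stereo (val x)) - 1 = 2 * d / (1 - d).
  rewrite !(dotZl, dotZr, dotDl, dotDr, dotNl, dotNr) !sphere_dot (dotC v') -/d.
  by field; rewrite gt_eqF.
rewrite /unstereo ss; have -> : 2 *: stereo (val x) + (2 * d / (1 - d)) *: v' =
    (2 / (1 - d)) *: val x.
  rewrite /stereo -/d !scalerA scalerBr scalerA -addrA -scaleNr -scalerDl.
  by rewrite [X in _ + X *: _](_ : _ = 0) ?scale0r ?addr0 //; ring.
by apply: to_sphereK; rewrite divr_gt0.
Qed.

(** Away from the pole the sphere is a plane, where the straight homotopy is
    available. *)
Lemma avoiding_homotopic x y (g h : R -> S) : is_path x y g -> is_path x y h ->
  (forall s, g s != v) -> (forall s, h s != v) -> path_homotopic x y g h.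
Proof.
move=> [cg g0 g1] [ch h0 h1] gv hv.
pose F (p : R * R) := (1 - clamp p.1) *: stereo (val (g p.2)) +
  clamp p.1 *: stereo (val (h p.2)).
have Fv p : dot (F p) v' = 0.
  by rewrite /F dotDl (dotZl (1 - _)) (dotZl (clamp _)) !stereo_orth !mulr0 addr0.
have cst (f : R -> S) : continuous f -> (forall s, f s != v) ->
    continuous (fun p : R * R => stereo (val (f p.2))).
  move=> cf fv; have cfv : continuous (fun p : R * R => val (f p.2)).
    by apply: cts_sphere_val; apply: (cts_comp _ cf); cts.
  have cd : continuous (fun p : R * R => dot (val (f p.2)) v').
    by apply: cts_dot => //; cts.
  apply: cts_scale.
    have cd1 : continuous (fun p : R * R => 1 - dot (val (f p.2)) v') by cts.
    move=> p; apply: cvgV; last exact: cd1.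
    by rewrite gt_eqF // subr_gt0; apply: unit_dot_lt; rewrite ?sphere_dot //; exact: fv.
  apply: cts_addv; first exact: cfv.
  by apply: cts_oppv; apply: cts_scale; [exact: cd|cts].
have cF : continuous F.
  have c1 : continuous (fun p : R * R => clamp p.1) by apply: (cts_comp _ clamp_cts); cts.
  by apply: cts_addv; apply: cts_scale; [cts|exact: cst|cts|exact: cst].
have cH : continuous (fun p => unstereo (F p)).
  apply: cts_to_sphere => [|p]; last exact: unstereo_neq0.
  have c2 : continuous (fun p => dot (F p) (F p)) by exact: cts_dot.
  by apply: cts_addv; apply: cts_scale => //; cts.
exists (fun p => unstereo (F p)); split=> [|s|s|t] //=.
- by rewrite /F /= clamp_le0 // subr0 scale0r addr0 scale1r stereoK.
- by rewrite /F /= clamp_ge1 // subrr scale0r add0r scale1r stereoK.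
split=> [|s s0|s s1].
- by apply: (cts_comp (f := fun s => (t, s)) _ cH); cts.
- by rewrite /F /= g0 // h0 // -scalerDl subrK scale1r stereoK // -(g0 _ s0).
- by rewrite /F /= g1 // h1 // -scalerDl subrK scale1r stereoK // -(g1 _ s1).
Qed.

End stereographic.

(** Both paths are homotopic to paths in finitely many planes, and these avoid a
    common point. *)
Lemma sphere_simply_connected x y (a b : Pi x y) : a = b.
Proof.
have [l [l0 [g [pg [-> gl]]]]] := planar_all a.
have [m [m0 [h [ph [-> hm]]]]] := planar_all b.
have [|v nv] := @off_planes (l ++ m).
  by move=> w; rewrite mem_cat => /orP[/l0|/m0].
apply/pcls_eqP/(avoiding_homotopic (v := v)) => // s; apply/eqP => e; apply: nv.
  by have [w wl ew] := gl s; exists w; [rewrite mem_cat wl|rewrite -e].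
by have [w wm ew] := hm s; exists w; [rewrite mem_cat wm orbT|rewrite -e].
Qed.

(** Nonopposite points are joined by an arc; opposite points need an intermediate
    point, taken orthogonal to both. *)
Lemma sphere_connected x y : exists a : Pi x y, True.
Proof.
have arc_Pi z z' : val z != - val z' -> exists a : Pi z z', True.
  move=> zz'; have := unit_dot_gt (sphere_dot z) (sphere_dot z') zz'.
  by move=> /arc_path pa; exists (pcls pa).
have [xy|xy] := eqVneq (val x) (- val y); last exact: arc_Pi.
have [w w0 [xw _]] := orthogonal_vector (val x) (val x).
have dxw : dot (val x) (val (to_sphere w)) = 0.
  by rewrite val_to_sphere // /normalize dotZr xw mulr0.
have [|a _] := arc_Pi x (to_sphere w).
  apply/eqP => e; move: dxw; rewrite {1}e dotNl sphere_dot => /eqP.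
  by rewrite oppr_eq0 oner_eq0.
have [|b _] := arc_Pi (to_sphere w) y; last by exists (Pcat a b).
rewrite -xy; apply/eqP => e; move: dxw; rewrite e sphere_dot => /eqP.
by rewrite oner_eq0.
Qed.

End simply_connected_sphere.

(** * The fundamental group of the projective plane *)

Section projective_plane.
Context {R : realType}.
Local Notation S := (sphere R 2).
Local Notation RP2 := (projective_space R 2).
Implicit Types (x y : S) (p q : RP2).

Lemma opp_sphere_subproof x : - val x \in S.
Proof. by apply/sphereP; rewrite dotNl dotNr opprK sphere_dot. Qed.

Definition opp_sphere x : S := SigSub (opp_sphere_subproof x).

Definition proj x : RP2 := \pi_RP2 x.

Lemma proj_cts : continuous proj.
Proof. exact: pi_continuous. Qed.

Definition rep p : S := repr p.

Lemma repK p : proj (rep p) = p.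
Proof. exact: reprK. Qed.

Lemma proj_eqP x y : proj x = proj y <-> y = x \/ y = opp_sphere x.
Proof.
split=> [/eqmodP/orP[]/eqP e|h].
- by left; apply: val_inj.
- by right; apply: val_inj; rewrite /= e opprK.
apply/eqmodP; rewrite /= /antipodal; case: h => ->; first by rewrite eqxx.
by rewrite /= opprK eqxx orbT.
Qed.

Lemma even_cts (T : topologicalType) (F : S -> T) : continuous F ->
  (forall x, F (opp_sphere x) = F x) -> continuous (fun p => F (rep p)).
Proof.
move=> cF eF; apply/quotient_continuous.
rewrite (_ : _ \o _ = F) //; apply/funext => x /=.
have : proj x = proj (rep (proj x)) by rewrite repK.
by case/proj_eqP => ->.
Qed.

Lemma sign_product (A B C : R) : 0 < A * (B * C) -> (B < 0) - (A < 0) = (C < 0).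
Proof.
have -> : forall a b : bool, a - b = a (+) b by [].
have [A0|A0|->] := ltgtP A 0; rewrite ?mul0r ?ltxx //.
  rewrite nmulr_rgt0 //; have [B0|B0|->] := ltgtP B 0; rewrite ?mul0r ?ltxx //.
    by rewrite nmulr_rlt0 // => C0; rewrite ltNge (ltW C0).
  by rewrite pmulr_rlt0 // => ->.
rewrite pmulr_rgt0 //; have [B0|B0|->] := ltgtP B 0; rewrite ?mul0r ?ltxx //.
  by rewrite nmulr_rgt0 // => ->.
by rewrite pmulr_rgt0 // => C0; rewrite ltNge (ltW C0).
Qed.

(** Choose a representative on the sphere for each point of the square. Relative
    to the representative at [z], the one at a nearby point [w] has the right
    sign or not ([D z w]); a primitive of [D] tells which representatives to
    replace by their opposites to get a continuous lift. Near a point [z1] this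
    lift is the normalization of [dot (r z1) u *: u] up to a global sign, which
    is even in the representative [u] and hence continuous. *)
Lemma square_lift (H : R * R -> RP2) : continuous H ->
    (forall t s, H (t, s) = H (clamp t, clamp s)) ->
  exists2 L : R * R -> S, continuous L & forall z, proj (L z) = H z.
Proof.
move=> cH Hc; pose r (z : R * R) := val (rep (H z)).
have rr z : dot (r z) (r z) = 1 by exact: sphere_dot.
pose D (z w : R * R) : bool := dot (r z) (r w) < 0.
have near_pos (F : S -> R) (z : R * R) : continuous F ->
    (forall x, F (opp_sphere x) = F x) -> 0 < F (rep (H z)) ->
    \forall w \near z, 0 < F (rep (H w)).
  move=> cF eF F0; have cFH : continuous (fun w => F (rep (H w))).
    exact: (cts_comp cH (even_cts cF eF)).
  exact: (cFH z _ (lt_nbhsr F0)).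
have cval : continuous (fun x : S => val x) by exact: cts_val.
have D_nonzero z : \forall w \near z, dot (r z) (r w) != 0.
  have : \forall w \near z, 0 < dot (r z) (r w) * dot (r z) (r w).
    apply: (near_pos (fun x => dot (r z) (val x) * dot (r z) (val x))).
    - have : continuous (fun x : S => dot (r z) (val x)) by apply: cts_dot => //; cts.
      by move=> ?; cts.
    - by move=> x; rewrite /= !dotNr mulrNN.
    - by rewrite rr mulr1.
  by apply: filterS => w; apply: contraTneq => ->; rewrite mulr0 ltxx.
have D_local z0 : \forall z \near z0, \forall w \near z, D z0 w - D z0 z = D z w.
  apply: filterS (D_nonzero z0) => z Az; set A := dot _ _ in Az.
  have : \forall w \near z, 0 < A * (dot (r z0) (r w) * dot (r z) (r w)).
    apply: (near_pos (fun x => A * (dot (r z0) (val x) * dot (r z) (val x)))).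
    - have c1 : continuous (fun x : S => dot (r z0) (val x)) by apply: cts_dot => //; cts.
      have c2 : continuous (fun x : S => dot (r z) (val x)) by apply: cts_dot => //; cts.
      by cts.
    - by move=> x; rewrite /= !dotNr mulrNN.
    - by rewrite rr mulr1 -expr2 exprn_even_gt0.
  by apply: filterS => w; rewrite /D -/A => /sign_product.
have [a aP] := monodromy D_local.
pose L0 (z : R * R) := if a z then opp_sphere (rep (H z)) else rep (H z).
pose cl (z : R * R) := (clamp z.1, clamp z.2).
have ccl : continuous cl.
  by apply: cts_pair; apply: (cts_comp _ clamp_cts); cts.
exists (fun z => L0 (cl z)); last first.
  move=> [t s]; rewrite /L0 /cl /= -Hc; case: (a _); last exact: repK.
  by rewrite -[RHS]repK; apply/esym/proj_eqP; right.
move=> z0; set z1 := cl z0.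
pose f p := dot (r z1) (val (rep p)) *: val (rep p).
have cf : continuous f.
  apply: (@even_cts _ (fun x => dot (r z1) (val x) *: val x)).
    by apply: cts_scale => //; apply: cts_dot => //; cts.
  by move=> x; rewrite /= dotNr scaleNr scalerN opprK.
pose G (z : R * R) : S := to_sphere ((if a z1 then -1 else 1) *: f (H (cl z))).
have cG : {for z0, continuous G}.
  apply: (@cts_to_sphere_at _ _ (fun z => (if a z1 then -1 else 1) *: f (H (cl z)))).
    have cfH : continuous (fun z => f (H (cl z))).
      by apply: (cts_comp _ cf); apply: (cts_comp _ cH).
    have cc : continuous (fun _ : R * R => (if a z1 then -1 else 1 : R)) by cts.
    exact: (cts_scale cc cfH).
  rewrite -/z1 /f rr scale1r scaler_eq0 negb_or; apply/andP; split.
    by case: (a z1); rewrite ?oppr_eq0 oner_eq0.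
  by rewrite -dot_eq0 rr oner_eq0.
have nG : \forall z \near z0, G z = L0 (cl z).
  have n1 : \forall z \near z0, dot (r z1) (r (cl z)) != 0 by exact: (ccl z0 _ (D_nonzero z1)).
  have n2 : \forall z \near z0, 0 <= (cl z).1 <= 1 -> 0 <= (cl z).2 <= 1 ->
      a (cl z) - a z1 = D z1 (cl z).
    by apply: (ccl z0 _ (aP z1 _ _)); rewrite clamp01.
  apply: filterS2 n1 n2 => z nz /(_ (clamp01 _) (clamp01 _)) /(canRL (subrK _)) az.
  rewrite /G /L0 az; set b := D _ _.
  have -> : b + a z1 = b (+) a z1 by [].
  rewrite /f -/(r (cl z)) scalerA.
  have negE (c : R) : c < 0 -> to_sphere (c *: r (cl z)) = opp_sphere (rep (H (cl z))).
    move=> c0; rewrite -[c]opprK scaleNr -scalerN.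
    by apply: (@to_sphereK R _ (opp_sphere _)); rewrite oppr_gt0.
  have posE (c : R) : 0 < c -> to_sphere (c *: r (cl z)) = rep (H (cl z)).
    by move=> c0; apply: to_sphereK.
  move: nz; rewrite /b /D neq_lt => /orP[d0|d0].
    rewrite d0; case: (a z1) => /=; first by rewrite mulN1r posE ?oppr_gt0.
    by rewrite mul1r negE.
  rewrite ltNge (ltW d0); case: (a z1) => /=; first by rewrite mulN1r negE ?oppr_lt0.
  by rewrite mul1r posE.
have e0 : G z0 = L0 z1 by exact: nbhs_singleton nG.
move=> W; rewrite -e0 => /cG nW.
have nW' : \forall z \near z0, W (G z) by [].
suff : \forall z \near z0, W (L0 (cl z)) by [].
by apply: filterS2 nG nW' => z <-.
Qed.

(** Two lifts are equal or opposite at each parameter; which of the two is a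
    locally constant alternative. *)
Lemma lift_unique (f g : R -> S) : continuous f -> continuous g ->
    (forall s, proj (f s) = proj (g s)) ->
  f 0 = g 0 -> f 1 = g 1.
Proof.
move=> cf cg fg fg0.
have cd : continuous (fun s => dot (val (f s)) (val (g s))).
  by apply: cts_dot; apply: cts_sphere_val.
have d1 s : f s = g s \/ dot (val (f s)) (val (g s)) = -1.
  have /esym/proj_eqP[->|->] := fg s; first by left.
  by right; rewrite /= dotNl sphere_dot.
have := @locally_constant01 R _ (fun s => 0 < dot (val (f s)) (val (g s))).
move=> /(_ _ 1); rewrite ler01 lexx fg0 sphere_dot ltr01 => h.
have : 0 < dot (val (f 1)) (val (g 1)).
  apply: h => // t _; have [e|e] := d1 t.
    have d0 : 0 < dot (val (f t)) (val (g t)) by rewrite e sphere_dot.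
    have : \forall s \near t, 0 < dot (val (f s)) (val (g s)).
      exact: (cd t _ (lt_nbhsr d0)).
    by apply: filterS => s -> _; rewrite d0.
  have d0 : dot (val (f t)) (val (g t)) < 0 by rewrite e; lra.
  have : \forall s \near t, dot (val (f s)) (val (g s)) < 0.
    exact: (cd t _ (lt_nbhsl d0)).
  by apply: filterS => s /ltW sd _; rewrite !ltNge sd (ltW d0).
by case: (d1 1) => // ->; rewrite oppr_gt0 ltr10.
Qed.

Lemma path_lift p q (g : R -> RP2) x : is_path p q g -> proj x = p ->
  exists h y, [/\ is_path x y h, proj y = q & forall s, proj (h s) = g s].
Proof.
move=> pg xp; have [cg g0 g1] := pg.
have [|t s|L cL LH] := @square_lift (fun z => g z.2).
- by apply: (cts_comp _ cg); cts.
- by rewrite /= (path_clamp _ pg).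
pose h s := L (0, clamp s).
have hg s : proj (h s) = g s by rewrite /h LH /= (path_clamp _ pg).
have ch : continuous h.
  apply: (cts_comp _ cL); apply: cts_pair; first by cts.
  by have := @clamp_cts R.
have h0 s : s <= 0 -> h s = h 0 by move=> s0; rewrite /h !clamp_le0.
have h1 s : 1 <= s -> h s = h 1 by move=> s1; rewrite /h !clamp_ge1.
have : proj (h 0) = proj x by rewrite hg g0 ?lexx.
case/proj_eqP => xh.
  by exists h, (h 1); rewrite hg g1 ?lexx // xh.
exists (fun s => opp_sphere (h s)), (opp_sphere (h 1)).
have hN s : proj (opp_sphere (h s)) = g s.
  by rewrite -hg; apply/esym/proj_eqP; right.
split=> //; last by rewrite hN g1 ?lexx.
split=> [|s s0|s s1]; [|by rewrite h0 // -xh|by rewrite h1].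
by apply: continuous_comp_initial; apply: cts_oppv; exact: cts_sphere_val.
Qed.

(** The nontrivial loop is the image of a path between opposite points [x] and
    [opp_sphere x]. A null-homotopy of it would lift to a square that is constant
    on three sides, while the fourth side joins opposite points. Every loop
    lifts to a path from [x] to [x] or to [opp_sphere x], and the sphere is
    simply connected, so there is one class of loops for each of the two ends. *)
Lemma projective_plane_like : @projective_like R RP2.
Proof.
split; first by exists (proj (to_sphere 0)).
  move=> p q; have [a _] := @sphere_connected R (rep p) (rep q).
  have [g [pg _]] := pclsP a.
  have := is_path_map proj_cts pg; rewrite !repK => pg'.
  by exists (pcls pg').
move=> p; pose x := rep p; have xp : proj x = p by exact: repK.
have Nxp : proj (opp_sphere x) = p.
  by rewrite -xp; apply/esym/proj_eqP; right.
have [a _] := @sphere_connected R x (opp_sphere x).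
have [g [pg _]] := pclsP a.
have := is_path_map proj_cts pg; rewrite xp Nxp => pg'.
have Nx : opp_sphere x <> x.
  move=> /(congr1 (fun z => dot (val z) (val x))); rewrite /= dotNl sphere_dot; lra.
exists (pcls pg') => [/pcls_eqP[H [cH H0 H1 Hp]]|b].
  have [|t s|L cL LH] := @square_lift (fun z => H (clamp z.1, z.2)).
  - apply: (cts_comp _ cH); apply: cts_pair; last by cts.
    by apply: (cts_comp _ clamp_cts); cts.
  - rewrite /= [clamp (clamp t)]clamp_id ?clamp01 //.
    by have /= -> := path_clamp s (Hp (clamp t)).
  have side (l : R -> R * R) : continuous l ->
      (forall s, H (clamp (l s).1, (l s).2) = p) -> L (l 1) = L (l 0).
    move=> cl lp; apply: (@lift_unique (fun s => L (l s)) (fun s => L (l 0))) => //.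
    - exact: (cts_comp cl cL).
    - by cts.
    - by move=> s; rewrite !LH !lp.
  have s0 : L (1, 0) = L (0, 0).
    apply: (side (fun t => (t, 0))) => [|s]; first by cts.
    by have [_ e _] := Hp (clamp s); exact: e (lexx 0).
  have s1 : L (1, 1) = L (0, 1).
    apply: (side (fun t => (t, 1))) => [|s]; first by cts.
    by have [_ _ e] := Hp (clamp s); exact: e (lexx 1).
  have s2 : L (1, 1) = L (1, 0).
    apply: (side (fun s => (1, s))) => [|s]; first by cts.
    by rewrite /= clamp_ge1 // H1.
  have L01 : L (0, 1) = L (0, 0) by rewrite -s1 s2 s0.
  have [cg g0 g1] := pg.
  have Lg s : proj (L (0, s)) = proj (g s) by rewrite LH /= clamp_le0 // H0.
  have cLs : continuous (fun s => L (0, s)) by apply: (cts_comp _ cL); cts.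
  have /esym/proj_eqP[e|e] := Lg 0.
    have := lift_unique cLs cg Lg e; rewrite g1 ?lexx // L01 e g0 ?lexx //.
    by move=> /esym.
  have cNg : continuous (fun s => opp_sphere (g s)).
    by apply: continuous_comp_initial; apply: cts_oppv; exact: cts_sphere_val.
  have LNg s : proj (L (0, s)) = proj (opp_sphere (g s)).
    by rewrite Lg; apply/proj_eqP; right.
  have := lift_unique cLs cNg LNg e; rewrite g1 ?lexx // L01 e g0 ?lexx //.
  move=> /(congr1 (fun z => dot (val z) (val x))).
  by rewrite /= !dotNl opprK sphere_dot; lra.
have [h [ph ->]] := pclsP b.
have [k [y [pk yp kh]]] := path_lift ph xp.
have : proj x = proj y by rewrite xp yp.
case/proj_eqP => ey; subst y.
  left; apply/pcls_eqP.
  have /pcls_eqP/(path_homotopic_map proj_cts) := sphere_simply_connected (pcls pk) (pcls (cst_path x)).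
  rewrite xp (_ : proj \o k = h); last by apply/funext => s; exact: kh.
  by rewrite (_ : proj \o _ = fun=> p) //; apply/funext => s /=.
right; apply/pcls_eqP.
have /pcls_eqP/(path_homotopic_map proj_cts) := sphere_simply_connected (pcls pk) (pcls pg).
by rewrite xp Nxp (_ : proj \o k = h) //; apply/funext => s; exact: kh.
Qed.

End projective_plane.

Theorem corollary5p8 (R : realType) (X : topologicalType)
    (hX : finite_model R (projective_space R 2) X) :
  (13 <= #|` fset_set [set: X]|)%N.
Proof.
have [finX XP] := hX.
have plX := (projective_like_equiv XP).2 (@projective_plane_like R).
by have [[x _] _ _] := plX; exact: projective_like_card finX x plX.
Qed.
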